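(* Let $\nu>0$, $\beta\in(0,1)$, $\alpha\in(0,2]$ and let $d\ge1$ be an integer with $d<\min\{2,\beta^{-1}\}\alpha$. Let $u_0:\mathbb{R}^d\to\mathbb{R}$ be measurable and bounded, and let $\sigma:\mathbb{R}\to\mathbb{R}$ (not assumed Lipschitz or of linear growth). Suppose that $\inf_{z\in\mathbb{R}^d}u_0(z)>0$ and that, for some $\epsilon>0$, $\inf_{y\in\mathbb{R},\,y\neq0}|\sigma(y)|/|y|^{1+\epsilon}>0$. Then there is no finite-energy solution to the time fractional stochastic heat type equation $$\partial_t^\beta u_t(x)=-\nu(-\Delta)^{\alpha/2}u_t(x)+I_t^{1-\beta}[\sigma(u)\dot W(t,x)],\quad t>0,\ x\in\mathbb{R}^d,\qquad u_t(x)|_{t=0}=u_0(x).$$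
   Context: Finite-energy solution. A random field $u$ is a finite energy solution of the equation when it is a (mild) solution, $u\in\bigcup_{\gamma>0}\mathcal{L}^{\gamma,2}$, and there exists $\rho_*>0$ such that $\int_0^\infty e^{-\rho_*t}\,\mathbb{E}(|u_t(x)|^2)\,dt<\infty$ for all $x\in\mathbb{R}^d$. Mild solution. An $\mathcal{F}_t$-adapted random field $u$ is a mild solution with initial value $u_0$ if $$u_t(x)=\int_{\mathbb{R}^d}u_0(y)G_t(x-y)\,dy+\int_0^t\int_{\mathbb{R}^d}\sigma(u_r(y))G_{t-r}(x-y)\,W(dr\,dy),$$ where it is part of the notion of solution that the stochastic (Walsh) integral is well defined. Kernel. $\partial_t^\beta u_t(x)=\frac{1}{\Gamma(1-\beta)}\int_0^t\partial_ru_r(x)\frac{dr}{(t-r)^\beta}$ is the Caputo derivative and $I_t^{\gamma}f(t)=\frac1{\Gamma(\gamma)}\int_0^t(t-\tau)^{\gamma-1}f(\tau)d\tau$. $G_t(x)$ is the fundamental solution of $\partial_t^\beta G_t(x)=-\nu(-\Delta)^{\alpha/2}G_t(x)$; explicitly, for $t>0$, $G_t(x)=\int_0^\infty p_s(x)f_{E_t}(s)\,ds$, where $p_s$ is the density on $\mathbb{R}^d$ with Fourier transform $e^{-s\nu|\xi|^\alpha}$, and $f_{E_t}(s)=t\beta^{-1}s^{-1-1/\beta}g_\beta(ts^{-1/\beta})$ is the density of the inverse $E_t$ of a $\beta$-stable subordinator $D$ with $\mathbb{E}e^{-\lambda D_1}=e^{-\lambda^\beta}$, $g_\beta$ being the density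 of $D_1$. Noise. $\dot W$ is a space-time white noise on $(0,\infty)\times\mathbb{R}^d$, i.e. a centered Gaussian family $W(f)$, $f\in L^2((0,\infty)\times\mathbb{R}^d)$, with $\mathbb{E}[W(f)W(g)]=\int_0^\infty\int_{\mathbb{R}^d}f(t,x)g(t,x)\,dx\,dt$, adapted to a complete right-continuous filtration $\{\mathcal{F}_t\}$. An elementary random field is $\Phi_t(x)=X1_{[a,b]}(t)\phi(x)$ with $0\le a<b$, $X\in L^2(\Omega)$ $\mathcal{F}_a$-measurable and $\phi\in L^2(\mathbb{R}^d)$; a simple random field is a finite sum of elementary ones (with disjoint supports). $\mathcal{L}^{\gamma,2}$ is the completion of the space of simple random fields in the norm $\mathcal{N}_{\gamma,2}(\Phi)=\sup_{t\ge0}\sup_{x\in\mathbb{R}^d}e^{-\gamma t}(\mathbb{E}|\Phi_t(x)|^2)^{1/2}$ (a.s.-equal fields identified). *)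

(* Defs.v *)
From HB Require Import structures.
From mathcomp Require Import all_boot all_order all_algebra.
From mathcomp Require Import all_classical all_reals all_analysis.

Set Implicit Arguments.
Unset Strict Implicit.
Unset Printing Implicit Defensive.

Import Order.TTheory GRing.Theory Num.Theory.
Import numFieldNormedType.Exports.

Local Open Scope classical_set_scope.
Local Open Scope ring_scope.

(* [lebesgue_measure] lives on [measurableTypeR R], which is R with the Borel
   sigma-algebra; the product sigma-algebra on tuples is then that of R^d. *)
Notation Rd R d := (d.-tuple (measurableTypeR R)).

Lemma product_measure_sigma_finite d1 d2 (T1 : measurableType d1)
    (T2 : measurableType d2) (R : realType)
    (m1 : {sigma_finite_measure set T1 -> \bar R})
    (m2 : {sigma_finite_measure set T2 -> \bar R}) :
  sigma_finite setT (m1 \x m2)%E.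
Proof.
have /sigma_finiteP[F [TF ndF Foo]] := sigma_finiteT m1.
have /sigma_finiteP[G [TG ndG Goo]] := sigma_finiteT m2.
exists (fun n => F n `*` G n).
  rewrite -setXTT TF TG predeqE => -[x y]; split.
    move=> [/= [n _ Fnx] [k _ Gky]]; exists (maxn n k) => //; split.
      by move: x Fnx; exact/subsetPset/ndF/leq_maxl.
    by move: y Gky; exact/subsetPset/ndG/leq_maxr.
  by move=> [n _ []/= ? ?]; split; exists n.
move=> k; have [? ?] := Foo k; have [? ?] := Goo k.
split; first exact: measurableX.
by rewrite product_measure1E// lte_mul_pinfty// ge0_fin_numE.
Qed.

Section lebesgue_Rd.
Context {R : realType}.

Definition cons_pair n (z : measurableTypeR R * Rd R n) : Rd R n.+1 :=
  [tuple of z.1 :: z.2].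

Lemma measurable_cons_pair n : measurable_fun setT (@cons_pair n).
Proof. exact: measurable_cons. Qed.

Section step.
Variables (n : nat) (m : {sigma_finite_measure set (Rd R n) -> \bar R}).

Definition lebesgue_cons : set (Rd R n.+1) -> \bar R :=
  pushforward (@lebesgue_measure R \x m)%E (@cons_pair n).

Let lebesgue_cons0 : lebesgue_cons set0 = 0%E.
Proof. by rewrite /lebesgue_cons /pushforward preimage_set0 measure0. Qed.

Let lebesgue_cons_ge0 A : (0 <= lebesgue_cons A)%E.
Proof. by rewrite /lebesgue_cons /pushforward measure_ge0. Qed.

Let lebesgue_cons_sigma_additive : semi_sigma_additive lebesgue_cons.
Proof.
have mpre A : measurable A -> measurable (@cons_pair n @^-1` A).
  by move=> mA; rewrite -[X in measurable X]setTI; exact: measurable_cons_pair.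
move=> F mF tF mUF; rewrite /lebesgue_cons /pushforward preimage_bigcup.
apply: measure_semi_sigma_additive => [k| |]; [exact: mpre| |].
- apply/trivIsetP => /= i j _ _ ij; rewrite -preimage_setI.
  by move/trivIsetP : tF => /(_ _ _ _ _ ij) ->//; rewrite preimage_set0.
- by rewrite -preimage_bigcup; exact: mpre.
Qed.

HB.instance Definition _ := isMeasure.Build _ _ _ lebesgue_cons
  lebesgue_cons0 lebesgue_cons_ge0 lebesgue_cons_sigma_additive.

Let lebesgue_cons_sigma_finite : sigma_finite setT lebesgue_cons.
Proof.
have [F FT Foo] := product_measure_sigma_finite (@lebesgue_measure R) m.
pose un (x : Rd R n.+1) : measurableTypeR R * Rd R n :=
  (thead x, [tuple of behead x]).
have unK z : un (cons_pair z) = z.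
  by case: z => a x; rewrite /un theadE; congr pair; exact/val_inj.
have mun : measurable_fun setT un.
  apply: measurable_fun_pair; last exact: measurable_behead.
  exact: measurable_tnth.
exists (fun k => un @^-1` F k).
  by rewrite -preimage_bigcup -FT preimage_setT.
move=> k; have [mF Fk] := Foo k; split.
  by rewrite -[X in measurable X]setTI; exact: mun.
rewrite /lebesgue_cons /pushforward -comp_preimage.
by rewrite (_ : un \o _ = id) //; apply/funext => z /=; rewrite unK.
Qed.

HB.instance Definition _ := Measure_isSigmaFinite.Build _ _ _ lebesgue_cons
  lebesgue_cons_sigma_finite.

End step.

(* Lebesgue measure on R^d, by recursion on d: the image of the product of the
   Lebesgue measures on R and R^(d-1) under (a, x) |-> a :: x. *)
Fixpoint lebesgue_Rd (d : nat) : {sigma_finite_measure set (Rd R d) -> \bar R} :=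
  match d with
  | 0%N => \d_([tuple] : Rd R 0)
  | k.+1 => lebesgue_cons (lebesgue_Rd k)
  end.

Definition dtdx (d : nat) : set (measurableTypeR R * Rd R d) -> \bar R :=
  (@lebesgue_measure R \x lebesgue_Rd d)%E.
Arguments dtdx : clear implicits.

HB.instance Definition _ (d : nat) := Measure.on (dtdx d).
HB.instance Definition _ (d : nat) := Measure_isSigmaFinite.Build _ _ _ (dtdx d)
  (product_measure_sigma_finite (@lebesgue_measure R) (lebesgue_Rd d)).

Definition subv d (x y : Rd R d) : Rd R d :=
  [tuple ((tnth x i : R) - (tnth y i : R) : measurableTypeR R) | i < d].

Definition dotv d (x y : Rd R d) : R :=
  \sum_(i < d) (tnth x i : R) * (tnth y i : R).

Definition normv d (x : Rd R d) : R := Num.sqrt (dotv x x).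

End lebesgue_Rd.
Arguments dtdx {R} d.

Definition square_integrable {disp} {T : measurableType disp} {R : realType}
    (mu : set T -> \bar R) (D : set T) (f : T -> R) : Prop :=
  measurable_fun D f /\ (\int[mu]_(x in D) ((f x) ^+ 2)%:E < +oo)%E.

Section kernel.
Context {R : realType}.
Local Notation pos := (`]0, +oo[%classic : set (measurableTypeR R)).

(* [p s] is the density with Fourier transform exp(-s nu |xi|^alpha): the real
   and imaginary parts of the transform are given by the integrals against cos
   and sin, and xi = 0 gives total mass 1.  A density is determined up to null
   sets only, and the integral over s in [heat_kernel] needs a version that is
   jointly measurable; which one is irrelevant, since [heat_kernel] is only
   used under integrals in the space variable. *)
Definition stable_density d (nu alpha : R) (p : R -> Rd R d -> R) : Prop :=
  [/\ measurable_fun (pos `*` [set: Rd R d]) (fun z => p z.1 z.2),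
      forall s x, 0 < s -> 0 <= p s x,
      forall s xi, 0 < s ->
        (\int[lebesgue_Rd d]_x (cos (dotv xi x) * p s x)%:E =
         (expR (- (s * nu * normv xi `^ alpha)))%:E)%E &
      forall s xi, 0 < s ->
        (\int[lebesgue_Rd d]_x (sin (dotv xi x) * p s x)%:E = 0)%E].

(* [g] is the density on (0, +oo) of a random variable D_1 > 0 such that
   E exp(-lambda D_1) = exp(-lambda^beta); lambda = 0 gives total mass 1. *)
Definition subordinator_density (beta : R) (g : R -> R) : Prop :=
  [/\ measurable_fun pos g,
      forall a, 0 < a -> 0 <= g a &
      forall lambda, 0 <= lambda ->
        (\int[lebesgue_measure]_(a in pos) (expR (- (lambda * a)) * g a)%:E =
         (expR (- (lambda `^ beta)))%:E)%E].

Definition inverse_subordinator_density (beta : R) (g : R -> R) (t s : R) : R :=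
  t * beta^-1 * s `^ (- 1 - beta^-1) * g (t * s `^ (- beta^-1)).

(* [Rintegral] returns 0 where the integral is infinite; for fixed t > 0 this
   happens on a null set of x (x = 0, if d >= alpha). *)
Definition heat_kernel d (beta : R) (p : R -> Rd R d -> R) (g : R -> R)
    (t : R) (x : Rd R d) : R :=
  \int[lebesgue_measure]_(s in pos)
    (p s x * inverse_subordinator_density beta g t s).

End kernel.

Section stochastic.
Context {R : realType} {disp : measure_display} {Omega : measurableType disp}
        (P : probability Omega R).

(* The usual conditions; completeness of [F 0] forces that of P.  Only indices
   t >= 0 are meaningful. *)
Definition filtration (F : R -> set (set Omega)) : Prop :=
  [/\ forall t, 0 <= t ->
        sigma_algebra setT (F t) /\ F t `<=` measurable,
      forall s t, 0 <= s -> s <= t -> F s `<=` F t,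
      forall t, 0 <= t -> \bigcap_(s in [set s | t < s]) F s `<=` F t &
      forall N, P.-negligible N -> F 0 N].

Definition measurable_wrt (G : set (set Omega)) (X : Omega -> R) : Prop :=
  forall B : set R, measurable B -> G (X @^-1` B).

(* [normal_prob 0 0] is not the Dirac mass at 0, whence the first case. *)
Definition centered_gaussian (X : Omega -> R) : Prop :=
  measurable_fun setT X /\
  ({ae P, forall w, X w = 0} \/
   exists2 s : R, 0 < s &
     forall B : set R, measurable B -> P (X @^-1` B) = normal_prob 0 s B).

Variable d : nat.
Implicit Types (F : R -> set (set Omega)).
Implicit Types (W : (measurableTypeR R * Rd R d -> R) -> Omega -> R).

Definition halfspace : set (measurableTypeR R * Rd R d) :=
  `]0, +oo[%classic `*` setT.

Definition L2_halfspace (f : measurableTypeR R * Rd R d -> R) : Prop :=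
  square_integrable (dtdx d) halfspace f.

(* White noise relative to the filtration: W(f) is F_t-measurable if f vanishes
   after time t and independent of F_t if f vanishes before time t.  Linearity
   of f |-> W(f) up to a.s. equality follows from the covariance. *)
Definition white_noise F W : Prop :=
  [/\ forall n (c : 'I_n -> R) (f : 'I_n -> measurableTypeR R * Rd R d -> R),
        (forall i, L2_halfspace (f i)) ->
        centered_gaussian (fun w => \sum_(i < n) c i * W (f i) w),
      forall f g, L2_halfspace f -> L2_halfspace g ->
        ('E_P[fun w => (W f w * W g w)%R] =
         \int[dtdx d]_(z in halfspace) (f z * g z)%:E)%E,
      forall t f, 0 <= t -> L2_halfspace f ->
        (forall z, t < z.1 -> f z = 0) -> measurable_wrt (F t) (W f) &
      forall t f, 0 <= t -> L2_halfspace f ->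
        (forall z, 0 < z.1 -> z.1 <= t -> f z = 0) ->
        forall A (B : set R), F t A -> measurable B ->
          P (A `&` W f @^-1` B) = (P A * P (W f @^-1` B))%E].

(* Data of the elementary random field X 1_[a, b](t) phi(x). *)
Record elementary := Elementary {
  el_start : R;
  el_end : R;
  el_coef : Omega -> R;
  el_space : Rd R d -> R }.

Definition is_elementary F (e : elementary) : Prop :=
  [/\ 0 <= el_start e < el_end e,
      measurable_wrt (F (el_start e)) (el_coef e),
      square_integrable P setT (el_coef e) &
      square_integrable (lebesgue_Rd d) setT (el_space e)].

(* Simple random fields are represented by lists of elementary ones.  The
   supports are not required to be disjoint: this is the linear space spanned
   by the elementary fields, which is the one to be completed. *)
Definition is_simple F (S : seq elementary) : Prop :=
  forall i : 'I_(size S), is_elementary F (tnth (in_tuple S) i).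

Definition simple_field (S : seq elementary) (t : R) (x : Rd R d) (w : Omega)
    : R :=
  \sum_(e <- S)
    el_coef e w * \1_(`[el_start e, el_end e]%classic : set R) t * el_space e x.

Definition simple_integral W (S : seq elementary) (w : Omega) : R :=
  \sum_(e <- S)
    el_coef e w *
    W (fun z => \1_(`[el_start e, el_end e]%classic : set R) z.1 *
                el_space e z.2) w.

(* [I] is the integral of Phi over (0, +oo) x R^d against W, and it is well
   defined: Phi is, up to a null set for dt dx dP, the L^2(dt dx dP) limit of
   simple fields whose integrals converge to I in L^2(P). *)
Definition walsh_integral F W (Phi : R -> Rd R d -> Omega -> R)
    (I : Omega -> R) : Prop :=
  measurable_fun setT I /\
  exists (Psi : measurableTypeR R * Rd R d * Omega -> R)
         (S : nat -> seq elementary),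
    [/\ measurable_fun (halfspace `*` setT) Psi,
        {ae (dtdx d \x P)%E, forall z,
          0 < (z.1.1 : R) -> Psi z = Phi z.1.1 z.1.2 z.2},
        forall n, is_simple F (S n),
        (\int[(dtdx d \x P)%E]_(z in halfspace `*` setT)
           ((simple_field (S n) z.1.1 z.1.2 z.2 - Psi z) ^+ 2)%:E)%E
          @[n --> \oo] --> (0%E : \bar R) &
        'E_P[fun w => ((simple_integral W (S n) w - I w) ^+ 2)%R]%E
          @[n --> \oo] --> (0%E : \bar R)].

Definition norm_gamma2 (gamma : R) (Phi : R -> Rd R d -> Omega -> R) : \bar R :=
  ereal_sup [set y | exists t x, 0 <= t /\
    y = ((expR (- (gamma * t)))%:E * Lnorm P 2%:E (EFin \o Phi t x))%E].

(* The completion of the simple fields of finite norm, realised concretely: the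
   norm controls each Phi_t(x) in L^2(P), so a Cauchy sequence of simple fields
   converges to a random field, determined up to a.s. equality of each
   Phi_t(x). *)
Definition L_gamma2 F (gamma : R) (u : R -> Rd R d -> Omega -> R) : Prop :=
  (forall t x, 0 <= t -> measurable_fun setT (u t x)) /\
  exists S : nat -> seq elementary,
    [/\ forall n, is_simple F (S n),
        forall n, (norm_gamma2 gamma (simple_field (S n)) < +oo)%E &
        norm_gamma2 gamma (fun t x w => simple_field (S n) t x w - u t x w)
          @[n --> \oo] --> (0%E : \bar R)].

Definition mild_solution F W (G : R -> Rd R d -> R) (sigma : R -> R)
    (u0 : Rd R d -> R) (u : R -> Rd R d -> Omega -> R) : Prop :=
  [/\ forall t x, 0 <= t -> measurable_wrt (F t) (u t x),
      forall x, {ae P, forall w, u 0 x w = u0 x} &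
      forall t x, 0 < t -> exists I : Omega -> R,
        walsh_integral F W
          (fun r y w =>
             \1_(`]0, t[%classic : set R) r *
             (sigma (u r y w) * G (t - r) (subv x y))) I /\
        {ae P, forall w,
          u t x w = \int[lebesgue_Rd d]_y (u0 y * G t (subv x y)) + I w}].

Definition finite_energy_solution F W (G : R -> Rd R d -> R) (sigma : R -> R)
    (u0 : Rd R d -> R) (u : R -> Rd R d -> Omega -> R) : Prop :=
  [/\ mild_solution F W G sigma u0 u,
      exists2 gamma : R, 0 < gamma & L_gamma2 F gamma u &
      exists2 rho : R, 0 < rho & forall x,
        (\int[lebesgue_measure]_(t in `[0%R, +oo[)
           ((expR (- (rho * t)))%:E * 'E_P[fun w => (`|u t x w| ^+ 2)%R]) < +oo)%E].

End stochastic.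

(* Main.v *)
Require Import Defs.
From HB Require Import structures.
From mathcomp Require Import all_boot all_order all_algebra.
From mathcomp Require Import all_classical all_reals all_analysis.
From mathcomp Require Import measurable_realfun.
From mathcomp Require Import ring lra.

(** Suppose that u is a solution. The mild formulation writes u_t(x) as a
    deterministic part, which is at least kappa = inf u0 because G_t has total mass
    1, plus a centered stochastic integral. The Walsh isometry gives, up to
    constants,
      E u_t(x)^2 >= kappa^2
        + integral over r in (0, t) and y of E sigma(u_r(y))^2 G_(t-r)(x-y)^2.
    As sigma grows like |y|^(1+eps), the expectation on the right is at least of
    order (E u_r(y)^2)^(1+eps), and the squared L^2 norm of the kernel is bounded below by
    C (t-r)^(-b), where b = beta d / alpha < 1. Hence the infimum over y of
    E u_r(y)^2 satisfies a superlinear Volterra inequality and blows up in finite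
    time: a lower bound a on some time interval becomes 2 a after a waiting time of
    order a^(-eps), and these times add up to a convergent geometric series
    ([moment_growth], [no_mild_solution]). But a stochastic integral that is well
    defined is square integrable, so E u_T(x)^2 is finite. This is a contradiction.

    There are two ingredients. The first is the lower bound of the kernel
    ([integral_heat_kernel_sqr]). By Cauchy-Schwarz it is enough that a fixed
    fraction of the mass of G_t lies in a box of radius of order t^(beta/alpha).
    For the stable densities this follows from the truncation inequality, which
    bounds tails by the characteristic function near 0 ([stable_density_box]); it is
    transferred to G_t by the change of variables between the subordinator and its
    inverse ([ge0_integral_powR_subst]).

    The second is the Walsh isometry for simple fields
    ([simple_integral_mean_isometry]). It rests on the independence of future noise
    from the past, and passes to the limit as the inequality [walsh_energy], with a
    constant factor lost. *)

Set Implicit Arguments.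
Unset Strict Implicit.
Unset Printing Implicit Defensive.

Import Order.TTheory GRing.Theory Num.Theory.
Import numFieldNormedType.Exports.

Local Open Scope classical_set_scope.
Local Open Scope ring_scope.

(** * Lebesgue measure on R^d *)

Section lebesgue_Rd_theory.
Context {R : realType}.
Local Notation mu := (@lebesgue_measure R).

Lemma lebesgue_measure_reflect (c : R) (A : set (measurableTypeR R)) :
  measurable A -> mu ((fun a : R => c - a) @^-1` A) = mu A.
Proof.
move=> mA.
have mf : measurable_fun setT (fun a : measurableTypeR R => c - a : measurableTypeR R).
  by apply: measurable_funB.
pose f : {mfun measurableTypeR R >-> measurableTypeR R} :=
  HB.pack (fun a : measurableTypeR R => c - a : measurableTypeR R)
    (isMeasurableFun.Build _ _ _ _ _ mf).
apply: (esym (@lebesgue_measure_unique R (pushforward mu f) _ A mA)).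
move=> _ [[a b] _ <-] /=.
rewrite /pushforward (_ : _ @^-1` _ = `[c - b, c - a[%classic); last first.
  by apply/seteqP; split=> x /=; rewrite !in_itv/=; lra.
rewrite !lebesgue_measure_itv/= !lte_fin ltrD2l ltrN2.
by case: ifP => // _; rewrite -!EFinB; congr EFin; ring.
Qed.

Lemma measurable_subv n (x : Rd R n) : measurable_fun setT (subv x).
Proof.
apply/measurable_fun_tnthP => i.
rewrite [X in measurable_fun _ X](_ : _ = (fun y : Rd R n => (tnth x i : R) - (tnth y i : R))).
  by apply: measurable_funB => //; exact: measurable_tnth.
by apply/funext => y /=; rewrite tnth_mktuple.
Qed.

Lemma subv_cons n (x : Rd R n.+1) z :
  subv x (cons_pair z) = cons_pair ((thead x : R) - (z.1 : R) : measurableTypeR R,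
                                    subv [tuple of behead x] z.2).
Proof.
apply: eq_from_tnth => i; rewrite tnth_mktuple.
case: (unliftP ord0 i) => [j|] ->.
  by rewrite !tnthS tnth_mktuple [in LHS](tuple_eta x) tnthS.
by rewrite !tnth0.
Qed.

Lemma ge0_integral_reflect (c : R) (f : R -> \bar R) :
  measurable_fun setT f -> (forall a, 0 <= f a)%E ->
  (\int[mu]_a f (c - a)%R = \int[mu]_a f a)%E.
Proof.
move=> mf f0.
have mg : measurable_fun setT (fun a : measurableTypeR R => c - a : measurableTypeR R).
  by apply: measurable_funB.
have := @ge0_integral_pushforward _ _ _ _ R _ mg mu setT f measurableT mf (fun _ _ => f0 _).
rewrite preimage_setT => <-.
by apply: eq_measure_integral => A mA _; exact: lebesgue_measure_reflect.
Qed.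

(** Reflection and translation act on the first coordinate and on the others
    separately, so the one-dimensional invariance propagates through the
    recursive product. *)
Lemma lebesgue_Rd_subv n (x : Rd R n) A : measurable A ->
  lebesgue_Rd n (subv x @^-1` A) = lebesgue_Rd n A.
Proof.
elim: n x A => [|n IH] x A mA.
  by have -> : subv x = id by apply/funext => y; apply: eq_from_tnth => -[].
have mc B : measurable B -> measurable (@cons_pair R n @^-1` B).
  by move=> mB; rewrite -[X in measurable X]setTI; exact: measurable_cons_pair.
rewrite /= /lebesgue_cons /pushforward.
rewrite {1}/product_measure1 [in RHS]/product_measure1.
rewrite -[RHS](ge0_integral_reflect (thead x)) /=; last 2 first.
- exact: measurable_fun_xsection (mc _ mA).
- by [].
apply: eq_integral => a _ /=.
rewrite -[RHS](IH [tuple of behead x]); last exact: measurable_xsection (mc _ mA).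
congr (lebesgue_Rd n _); apply/seteqP; split => y /=; by rewrite /xsection /= !inE /= subv_cons.
Qed.

Lemma ge0_integral_subv n (x : Rd R n) (f : Rd R n -> \bar R) :
  measurable_fun setT f -> (forall y, 0 <= f y)%E ->
  (\int[lebesgue_Rd n]_y f (subv x y) = \int[lebesgue_Rd n]_y f y)%E.
Proof.
move=> mf f0.
have := @ge0_integral_pushforward _ _ _ _ R _ (measurable_subv x)
  (lebesgue_Rd n) setT f measurableT mf (fun _ _ => f0 _).
rewrite preimage_setT => <-.
apply: eq_measure_integral => [|mg A mA _]; first exact: measurable_subv.
exact: lebesgue_Rd_subv.
Qed.

(** The sup-norm ball: unlike the Euclidean one it is a product, so its measure
    is immediate and its complement is a union of one-coordinate tails. *)
Definition box n (rho : R) : set (Rd R n) :=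
  [set x | forall i, `|tnth x i : R| <= rho].
Arguments box : clear implicits.

Lemma box0 rho : box 0 rho = setT.
Proof. by apply/seteqP; split => // x _ []. Qed.

Lemma box_cons n rho : @cons_pair R n @^-1` box n.+1 rho =
  `[- rho, rho]%classic `*` box n rho.
Proof.
apply/seteqP; split => [z bz|z [/= z1 z2] i].
  split => /=; last by move=> i; have := bz (lift ord0 i); rewrite tnthS.
  by rewrite in_itv /= -ler_norml; have := bz ord0; rewrite tnth0.
case: (unliftP ord0 i) => [j|] ->; first by rewrite tnthS.
by rewrite tnth0 ler_norml; rewrite in_itv in z1.
Qed.

Lemma measurable_box n rho : measurable (box n rho).
Proof.
have -> : box n rho = \bigcap_(i in [set: 'I_n]) [set x : Rd R n | `|tnth x i : R| <= rho].
  by apply/seteqP; split => x /= h i; [move=> _|]; exact: h.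
apply: fin_bigcap_measurable => // i _.
rewrite -[X in measurable X]setTI.
have : measurable_fun setT (fun x : Rd R n => `|tnth x i : R|).
  by apply: measurableT_comp => //; exact: measurable_tnth.
move=> /(_ measurableT `]-oo, rho]%classic (measurable_itv _)).
by congr (measurable (_ `&` _)); apply/seteqP; split => x /=; rewrite in_itv.
Qed.

Lemma measurable_coord_gt n (i : 'I_n) rho :
  measurable [set x : Rd R n | rho < `|tnth x i : R|].
Proof.
rewrite -[X in measurable X]setTI.
have : measurable_fun setT (fun x : Rd R n => `|tnth x i : R|).
  by apply: measurableT_comp => //; exact: measurable_tnth.
move=> /(_ measurableT `]rho, +oo[%classic (measurable_itv _)).
by congr (measurable (_ `&` _)); apply/seteqP; split => x /=; rewrite in_itv/= andbT.
Qed.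

Lemma lebesgue_Rd_box n rho : 0 <= rho ->
  lebesgue_Rd n (box n rho) = ((2 * rho) ^+ n)%:E.
Proof.
move=> r0; elim: n => [|n IH]; first by rewrite box0 /= diracT.
rewrite /= /lebesgue_cons /pushforward box_cons product_measure1E//; last first.
  exact: measurable_box.
rewrite [X in (_ * X)%E]IH exprS EFinM; congr (_ * _)%E.
transitivity (mu `[- rho, rho]%classic) => //.
rewrite lebesgue_measure_itv /= lte_fin.
case: ltP => h; first by rewrite -EFinB; congr EFin; ring.
by have -> : rho = 0; [lra|rewrite mulr0].
Qed.

End lebesgue_Rd_theory.
Arguments box {R} n rho.

(** * Integrals of squares, and measures with a density *)

Section measure_generalities.
Context d (T : measurableType d) (R : realType).
Variable mu : {measure set T -> \bar R}.

(** Cauchy-Schwarz on [B], in the elementary form 2 l f <= f^2 + l^2 with the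
    optimal l = c / m. *)
Lemma integral_sqr_ge (f : T -> R) (B : set T) (m c : R) :
  measurable_fun setT f -> (forall x, 0 <= f x) ->
  measurable B -> mu B = m%:E -> 0 < m -> 0 <= c ->
  (c%:E <= \int[mu]_(x in B) (f x)%:E)%E ->
  ((c ^+ 2 / m)%:E <= \int[mu]_x ((f x) ^+ 2)%:E)%E.
Proof.
move=> mf f0 mB muB m0 c0 cf.
set l := c / m; have l0 : 0 <= l by rewrite divr_ge0// ltW.
have l20 : 0 <= 2 * l by rewrite mulr_ge0.
have mf2 D : measurable_fun D (fun x => (f x ^+ 2)%:E).
  by apply/measurable_EFinP; exact: measurable_funTS (measurable_funX _ mf).
apply: (@le_trans _ _ (\int[mu]_(x in B) (f x ^+ 2)%:E)%E); last first.
  by apply: ge0_subset_integral => // x _; rewrite lee_fin sqr_ge0.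
rewrite -(@leeD2rE _ ((l ^+ 2 * m)%:E)) //.
have -> : ((c ^+ 2 / m)%:E + (l ^+ 2 * m)%:E = (2 * l)%:E * c%:E)%E.
  rewrite -EFinM -EFinD; congr EFin; rewrite /l; field; exact: lt0r_neq0.
apply: (@le_trans _ _ (\int[mu]_(x in B) ((2 * l)%:E * (f x)%:E))%E).
  rewrite ge0_integralZl_EFin//.
  - by apply: lee_wpmul2l.
  - by move=> x _; rewrite lee_fin.
  - exact/measurable_EFinP/measurable_funTS.
have -> : ((l ^+ 2 * m)%:E = \int[mu]_(x in B) (l ^+ 2)%:E)%E.
  by rewrite integral_cst// muB EFinM.
rewrite -ge0_integralD//; last 2 first.
- by move=> x _; rewrite lee_fin sqr_ge0.
- by move=> x _; rewrite lee_fin sqr_ge0.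
apply: ge0_le_integral => //.
- by move=> x _; rewrite -EFinM lee_fin mulr_ge0.
- by apply: emeasurable_funM => //; exact/measurable_EFinP/measurable_funTS.
- by apply: emeasurable_funD => //.

- move=> x _; rewrite -EFinM -EFinD lee_fin.
  have := sqr_ge0 (f x - l); nra.
Qed.

End measure_generalities.

Section density_measure.
Context d (T : measurableType d) (R : realType).
Variable mu : {measure set T -> \bar R}.
Variable w : T -> R.
Hypothesis mw : measurable_fun setT w.
Hypothesis w0 : forall x, 0 <= w x.

Definition density_measure (A : set T) : \bar R :=
  (\int[mu]_(x in A) (w x)%:E)%E.

Let density0 : density_measure set0 = 0%E.
Proof. exact: integral_set0. Qed.

Let density_ge0 A : (0 <= density_measure A)%E.
Proof. by apply: integral_ge0 => x _; rewrite lee_fin. Qed.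

Let density_sigma_additive : semi_sigma_additive density_measure.
Proof.
move=> F mF tF mUF; rewrite /density_measure ge0_integral_bigcup//.
- apply: is_cvg_ereal_nneg_natsum_cond => n _ _; exact: density_ge0.
- exact/measurable_EFinP/measurable_funTS.
- by move=> x _; rewrite lee_fin.
Qed.

HB.instance Definition _ := isMeasure.Build _ _ _ density_measure
  density0 density_ge0 density_sigma_additive.

Definition measure_of_density : {measure set T -> \bar R} := density_measure.

Import HBNNSimple.

(** Both sides commute with increasing limits, which reduces the identity to
    simple functions, and then to indicators. *)
Lemma ge0_integral_density (h : T -> \bar R) :
  measurable_fun setT h -> (forall x, 0 <= h x)%E ->
  (\int[density_measure]_x h x = \int[mu]_x (h x * (w x)%:E))%E.
Proof.
move=> mh h0.
pose f_ := nnsfun_approx measurableT mh.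
have mwE : measurable_fun setT (fun x => (w x)%:E) by exact/measurable_EFinP.
have fE n (x : T) : (f_ n x)%:E =
    (\sum_(k \in range (f_ n)) (k * \1_(f_ n @^-1` [set k]) x)%:E)%E.
  by rewrite fsumEFin// -fimfunE.
have ndf (x : T) : nondecreasing_seq (fun n => (f_ n x)%:E).
  by move=> m n mn; rewrite lee_fin; exact/lefP/nd_nnsfun_approx.
have cvf x : (f_ n x)%:E @[n --> \oo] --> h x.
  by apply: cvg_nnsfun_approx.
transitivity (limn (fun n => \int[density_measure]_x (f_ n x)%:E)%E).
  rewrite -monotone_convergence.
  - by apply: eq_integral => x _; apply/esym/cvg_lim.
  - by [].
  - by move=> n; exact/measurable_EFinP.
  - by move=> n x _; rewrite lee_fin.
  - by move=> x _ m n mn; exact: ndf.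
transitivity (limn (fun n => \int[mu]_x ((f_ n x)%:E * (w x)%:E))%E); last first.
  rewrite -monotone_convergence.
  - apply: eq_integral => x _; apply/cvg_lim => //.
    by apply: cvgeZr => //; exact: cvf.
  - by [].
  - by move=> n; apply: emeasurable_funM => //; exact/measurable_EFinP.
  - by move=> n x _; rewrite mule_ge0// lee_fin.
  - by move=> x _ m n mn; apply: lee_wpmul2r; rewrite ?lee_fin//; exact: ndf.
congr (limn _); apply/funext => n.
under [LHS]eq_integral do rewrite fE.
rewrite ge0_integral_fsum//; last 2 first.
- by move=> y; exact/measurable_EFinP/measurable_funM.
- by move=> y x _; rewrite nnfun_muleindic_ge0.
have fwE x : ((f_ n x)%:E * (w x)%:E)%E = (\sum_(k \in range (f_ n))
    ((k * \1_(f_ n @^-1` [set k]) x)%:E * (w x)%:E))%E.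
  by rewrite fE ge0_mule_fsuml// => k; exact: nnfun_muleindic_ge0.
under [RHS]eq_integral do rewrite fwE.
rewrite ge0_integral_fsum//; last 2 first.
- by move=> y; apply: emeasurable_funM => //; exact/measurable_EFinP/measurable_funM.
- by move=> y x _; apply: mule_ge0; [exact: nnfun_muleindic_ge0|rewrite lee_fin].
apply: eq_fsbigr => k kf.
have k0 : 0 <= k by move: kf; rewrite inE => -[x _ <-].
under [LHS]eq_integral do rewrite EFinM.
rewrite ge0_integralZl_EFin; [|by []|by []|exact/measurable_EFinP|by []].
under [RHS]eq_integral do rewrite EFinM -muleA.
rewrite [RHS]ge0_integralZl_EFin; [|by []| | |by []]; last 2 first.
- by move=> x _; rewrite mule_ge0// lee_fin.
- by apply: emeasurable_funM => //; exact/measurable_EFinP.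
congr (_ * _)%E; rewrite integral_indic// setIT /= /density_measure.
rewrite integral_mkcond; apply: eq_integral => x _.
rewrite patchE indicE; case: ifPn => _; by rewrite (mul1e, mul0e).
Qed.

End density_measure.

(** * The substitution a = t s^(-c) for measurable integrands *)

Section power_substitution.
Context {R : realType}.
Local Notation mu := (@lebesgue_measure R).
Local Notation pos := (`]0, +oo[%classic : set (measurableTypeR R)).
Variables t c : R.
Hypotheses (t0 : 0 < t) (c0 : 0 < c).

Let phi (s : R) : R := t * s `^ (- c).
Let w (s : R) : R := t * c * s `^ (- 1 - c).
Let W : measurableTypeR R -> R := w \_ pos.
Let theta (b : R) : R := (t / b) `^ c^-1.

Let theta_gt0 (b : R) : 0 < b -> 0 < theta b.
Proof. by move=> b0; rewrite powR_gt0// divr_gt0. Qed.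

Let phi_gt0 (s : R) : 0 < s -> 0 < phi s.
Proof. by move=> s0; rewrite mulr_gt0// powR_gt0. Qed.

Let phi_theta (b : R) : 0 < b -> phi (theta b) = b.
Proof.
move=> b0; rewrite /phi /theta -powRrM mulrN mulVf ?gt_eqF//.
rewrite powRN powRr1; last by rewrite ltW// divr_gt0.
by field; rewrite !gt_eqF.
Qed.

Let phi_le (b s : R) : 0 < b -> 0 < s -> (phi s <= b) = (theta b <= s).
Proof.
move=> b0 s0; rewrite -[in LHS](phi_theta b0) /phi ler_pM2l// !powRN.
have th0 := theta_gt0 b0.
rewrite lef_pV2; [|by rewrite posrE powR_gt0|by rewrite posrE powR_gt0].
have [h|h] := leP (theta b) s.
  by rewrite ge0_ler_powR// ?nnegrE// ltW.
apply/negbTE; rewrite -ltNge; apply: gt0_ltr_powR => //; by rewrite nnegrE ltW.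
Qed.

Let phi_cvg0 : phi x @[x --> +oo] --> (0 : R).
Proof.
apply/cvgrPdist_le => e e0; near=> s.
have s0 : 0 < s by near: s; exact: nbhs_pinfty_gt.
rewrite sub0r normrN gtr0_norm ?phi_gt0// phi_le//.
Unshelve. all: by end_near. Qed.

Let phi_derive (s : R) : 0 < s -> is_derive s 1 phi (- w s).
Proof.
move=> s0.
have := @is_deriveZ R R R (fun x => x `^ (- c)) t s 1 _ (is_derive1_powR (- c) s0).
have -> : t *: (- c * s `^ (- c - 1)) = - w s.
  rewrite (_ : - c - 1 = - 1 - c); last by ring.
  by rewrite /w /GRing.scale /=; ring.
by [].
Qed.

Let mphi : measurable_fun setT (phi : measurableTypeR R -> measurableTypeR R).
Proof. by apply: measurable_funM => //; exact: measurable_powR. Qed.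

Let mw : measurable_fun setT (w : measurableTypeR R -> R).
Proof. by apply: measurable_funM => //; exact: measurable_powR. Qed.

Let w0 s : 0 <= w s.
Proof. by rewrite !mulr_ge0 ?powR_ge0// ltW. Qed.

Let mW : measurable_fun setT W.
Proof.
apply/(measurable_restrictT _ _).1 => //; exact: measurable_funTS.
Qed.

Let W0 s : 0 <= W s.
Proof. by rewrite /W patchE; case: ifP. Qed.

Let continuous_w (s : R) : 0 < s -> {for s, continuous w}.
Proof.
move=> s0; apply: continuousM; first exact: cvg_cst.
apply: differentiable_continuous; apply/derivable1_diffP.
by apply: derivable_powR; rewrite in_itv/= s0.
Qed.

(** The fundamental theorem of calculus: phi decreases to 0 with derivative - w. *)
Let integral_w_tail (b : R) : 0 < b ->
  (\int[mu]_(x in `[theta b, +oo[) (w x)%:E = b%:E)%E.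
Proof.
move=> b0; have th0 := theta_gt0 b0.
have dphi x : theta b <= x -> is_derive x 1 phi (- w x).
  by move=> bx; apply: phi_derive; exact: lt_le_trans bx.
rewrite (@ge0_continuous_FTC2y R w (fun x => - phi x) _ 0).
- by rewrite phi_theta// sub0e EFinN oppeK.
- by [].
- apply/continuous_within_itvcyP; split.
    by move=> x; rewrite in_itv/= andbT => bx; apply: continuous_w; exact: lt_trans bx.
  exact: cvg_at_right_filter (continuous_w th0).
- by rewrite -oppr0; exact: cvgN.
- move=> x bx; have dx := dphi x (ltW bx).
  by apply: derivableN; exact: (@ex_derive _ _ _ _ _ _ _ dx).
- apply: cvgN; apply: cvg_at_right_filter.
  have dx := dphi _ (lexx _).
  by apply: differentiable_continuous; apply/derivable1_diffP; exact: (@ex_derive _ _ _ _ _ _ _ dx).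
- move=> x; rewrite in_itv/= andbT => bx; have dx := dphi x (ltW bx).
  rewrite derive1E deriveN; last exact: (@ex_derive _ _ _ _ _ _ _ dx).
  by rewrite (@derive_val _ _ _ _ _ _ _ dx) opprK.
Qed.

Let nu := pushforward (density_measure mu W)
  (phi : measurableTypeR R -> measurableTypeR R).

Let nu_le (b : R) : nu `]-oo, b]%classic = (Num.max b 0)%:E.
Proof.
rewrite /nu /pushforward /density_measure /= integral_mkcond.
have [b0|b0] := leP b 0.
  rewrite -[RHS](@integral0 _ _ _ mu setT); apply: eq_integral => s _.
  rewrite patchE; case: ifPn => //; rewrite inE /= in_itv /= => sb.
  rewrite /W patchE; case: ifPn => //; rewrite inE /= in_itv /= andbT => s0.
  by have := phi_gt0 s0; rewrite ltNge (le_trans sb b0).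
rewrite -(integral_w_tail b0) [RHS]integral_mkcond.
apply: eq_integral => s _; rewrite !patchE.
case: ifPn; rewrite ?notin_setE ?inE /= in_itv /= => sb.
- rewrite /W patchE; case: ifPn; rewrite ?notin_setE ?inE /= in_itv /= andbT => s0.
    by rewrite mem_set//= in_itv/= andbT -phi_le.
  rewrite memNset//= in_itv/= andbT => sb'.
  by apply: s0; exact: lt_le_trans (theta_gt0 b0) sb'.
- rewrite memNset//= in_itv/= andbT => sb'; apply: sb; rewrite phi_le//.
  exact: lt_le_trans (theta_gt0 b0) sb'.
Qed.

Let nu_add (a b : R) : a <= b ->
  (nu `]a, b]%classic + (Num.max a 0)%:E = (Num.max b 0)%:E)%E.
Proof.
move=> ab; rewrite -!nu_le addeC.
have mp B : measurable B -> measurable (phi @^-1` B).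
  by move=> mB; rewrite -[X in measurable X]setTI; exact: mphi.
rewrite /nu /pushforward -measureU; last first.
- rewrite -preimage_setI (_ : _ `&` _ = set0) ?preimage_set0//.
  by apply/seteqP; split => x //= []; rewrite !in_itv/=; lra.
- exact: mp.
- exact: mp.
rewrite -preimage_setU; congr (density_measure _ _ (_ @^-1` _)).
by apply/seteqP; split => x /=; rewrite !in_itv/=; lra.
Qed.

(** [nu] is Lebesgue measure on (0, +oo). It is compared with Lebesgue measure on
    the whole line, after adding back the part on (-oo, 0], because uniqueness of
    Lebesgue measure is tested on all half-open intervals. *)
Let lebesgueE A : measurable A -> (mu A = mu (A `&` `]-oo, 0%R]) + nu A)%E.
Proof.
have mD : measurable (`]-oo, 0%R]%classic : set (measurableTypeR R)).
  exact: measurable_itv.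
pose m' := measure_add (mrestr mu mD)
  (pushforward (measure_of_density mu mW W0) (phi : measurableTypeR R -> measurableTypeR R)).
pose m := m' mphi.
have mE B : m B = (mu (B `&` `]-oo, 0%R]) + nu B)%E by rewrite /m /m' measure_addE.
move=> mA; rewrite -mE.
apply: lebesgue_measure_unique => // _ [[a b] _ <-].
transitivity (mu (`]a, b]%classic `&` `]-oo, 0%R]%classic) + nu `]a, b]%classic)%E; last first.
  exact: (esym (mE _)).
have [ab|ba] := leP a b; last first.
  by rewrite set_itv_ge ?set0I /nu /pushforward ?preimage_set0 ?measure0
    ?/density_measure ?integral_set0 ?adde0// bnd_simp -leNgt ltW.
rewrite (_ : _ `&` _ = `]a, Num.min b 0]%classic); last first.
  by apply/seteqP; split => x /=; rewrite !in_itv/= le_min; lra.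
rewrite !lebesgue_measure_itv /= !lte_fin.
have := nu_add ab.
case: (nu _) => [r| |] // /(congr1 fine) /=; rewrite lt_min.
have [b0|b0] := leP b 0; have [a0|a0] := ltP a 0; have [h|h] := ltP a b => /= hr;
  rewrite -?EFinB -?EFinD ?add0e; by congr EFin; lra.
Qed.

(** The integrand is only measurable, as it will be a probability density, so
    the substitution is proved as an equality of measures: the image under
    s |-> t s^(-c) of the density |d/ds (t s^(-c))| is Lebesgue measure. *)
Lemma ge0_integral_powR_subst (h : R -> \bar R) :
  measurable_fun setT h -> (forall a, 0 <= h a)%E ->
  (\int[mu]_(s in pos) (h (t * s `^ (- c))%R * (t * c * s `^ (- 1 - c))%:E) =
   \int[mu]_(a in pos) h a)%E.
Proof.
move=> mh h0.
have mpos : measurable pos by exact: measurable_itv.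
pose h' := h \_ pos.
have h'0 a : (0 <= h' a)%E by rewrite /h' patchE; case: ifP.
have mh' : measurable_fun setT h'.
  by apply/(measurable_restrictT _ _).1 => //; exact: measurable_funTS.
transitivity (\int[pushforward (measure_of_density mu mW W0)
  (phi : measurableTypeR R -> measurableTypeR R)]_(a in pos) h a)%E; last first.
  apply: eq_measure_integral => A mA Apos /=.
  rewrite (lebesgueE mA) (_ : _ `&` _ = set0) ?measure0 ?add0e//.
  apply/seteqP; split => // x /= [/Apos]; rewrite /= !in_itv/=; lra.
rewrite [RHS]integral_mkcond -/h' ge0_integral_pushforward// preimage_setT.
rewrite (ge0_integral_density mu mW W0) /=; last 2 first.
- exact: measurableT_comp.
- by move=> x; exact: h'0.
rewrite integral_mkcond; apply: eq_integral => s _.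
rewrite /h' /W !patchE; case: ifPn; rewrite ?notin_setE ?inE /= in_itv /= andbT => s0;
  last by rewrite mule0.
by rewrite mem_set//= in_itv/= andbT phi_gt0.
Qed.

End power_substitution.

(** * Tails of the stable densities *)

Section truncation.
Context {R : realType}.
Local Notation mu := (@lebesgue_measure R).

(** The average of 1 - cos (a y) over a in [0, h] is 1 - sin (h y) / (h y), which
    is at least 1 / 2 as soon as |h y| >= 2. *)
Lemma integral_one_minus_cos_ge (y h : R) : 0 < h -> 2 <= `|y| * h ->
  ((h / 2)%:E <= \int[mu]_(a in `[0%R, h]) (1 - cos (a * y))%:E)%E.
Proof.
move=> h0 yh.
have y0 : y != 0 by apply: contraTneq yh => ->; rewrite normr0 mul0r; lra.
pose F (a : R) := a - y^-1 * sin (a * y).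
have dF (a : R) : is_derive a 1 F (1 - cos (a * y)).
  have d1 : is_derive a 1 (fun b : R => b * y) y.
    have := @is_deriveZ R R R id y a 1 _ (is_derive_id a 1).
    rewrite (_ : y \*: id = (fun b : R => b * y)); last first.
      by apply/funext => b; rewrite /= mulrC.
    by rewrite (_ : y *: 1 = y) // /GRing.scale /= mulr1.
  have d2 := @is_derive1_comp R sin (fun b : R => b * y) a _ _ (is_derive_sin _) d1.
  have d3 := @is_deriveZ R R R (sin \o (fun b => b * y)) y^-1 a 1 _ d2.
  have := @is_deriveB R R R id (y^-1 \*: (sin \o (fun b => b * y))) a 1 _ _ (is_derive_id a 1) d3.
  rewrite (_ : y^-1 *: (cos (a * y) * y) = cos (a * y)) //.
  by rewrite /GRing.scale /= mulrCA mulVf// mulr1.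
have cc (a : R) : {for a, continuous (fun a : R => 1 - cos (a * y))}.
  apply: cvgB; first exact: cvg_cst.
  apply: (@continuous_comp _ _ _ (fun b : R => b * y) cos); last exact: continuous_cos.
  by apply: cvgM; [exact: cvg_id|exact: cvg_cst].
have cF (a : R) : {for a, continuous F}.
  apply: differentiable_continuous; apply/derivable1_diffP.
  exact: (@ex_derive _ _ _ _ _ _ _ (dF a)).
rewrite (@continuous_FTC2 R _ F)//.
- rewrite -EFinB lee_fin /F mul0r sin0 mulr0 subrr subr0.
  have : `|y^-1 * sin (h * y)| <= h / 2.
    rewrite normrM normfV; apply: (@le_trans _ _ (`|y|^-1 * 1)).
      apply: ler_wpM2l => //.
      by rewrite ler_norml sin_geN1 sin_le1.
    rewrite mulr1 ler_pdivlMr// mulrC ler_pdivrMr ?normr_gt0//; lra.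
  rewrite ler_norml => /andP[_]; lra.
- by apply: continuous_subspaceT => a; exact: cc.
- split.
  + by move=> x _; exact: (@ex_derive _ _ _ _ _ _ _ (dF x)).
  + exact: cvg_at_right_filter (cF 0).
  + exact: cvg_at_left_filter (cF h).
- by move=> x _; rewrite derive1E (@derive_val _ _ _ _ _ _ _ (dF x)).
Qed.

End truncation.

Section stable.
Context {R : realType}.
Variables (d : nat) (nu alpha : R) (p : R -> Rd R d -> R).
Hypotheses (nu0 : 0 < nu) (alpha0 : 0 < alpha).
Hypothesis sp : stable_density nu alpha p.
Local Notation mu := (@lebesgue_measure R).
Local Notation pos := (`]0, +oo[%classic : set (measurableTypeR R)).

Lemma measurable_stable_density s : 0 < s -> measurable_fun setT (p s).
Proof.
move=> s0; have [mp _ _ _] := sp.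
have -> : p s = (fun z : measurableTypeR R * Rd R d => p z.1 z.2) \o pair s by [].
apply: measurable_comp mp _; last exact: pair1_measurable.
- by apply: measurableX => //; exact: measurable_itv.
- by move=> _ [x _ <-]; split => //=; rewrite in_itv/= s0.
Qed.

Lemma integral_stable_density s : 0 < s ->
  (\int[lebesgue_Rd d]_x (p s x)%:E = 1)%E.
Proof.
move=> s0; have [_ _ cp _] := sp.
have := cp s [tuple (0 : measurableTypeR R) | i < d] s0.
have dot0 x : dotv [tuple (0 : measurableTypeR R) | i < d] x = 0.
  by rewrite /dotv big1// => i _; rewrite tnth_mktuple mul0r.
under eq_integral do rewrite dot0 cos0 mul1r.
by rewrite /normv dot0 sqrtr0 powR0 ?gt_eqF// mulr0 oppr0 expR0.
Qed.

Lemma integral_one_minus_cos_stable s i (a : R) : 0 < s -> 0 <= a ->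
  (\int[lebesgue_Rd d]_x ((1 - cos (a * (tnth x i : R))) * p s x)%:E =
   (1 - expR (- (s * nu * a `^ alpha)))%:E)%E.
Proof.
move=> s0 a0; have [_ p0 cp _] := sp.
pose xi : Rd R d := [tuple (if j == i then a else 0 : measurableTypeR R) | j < d].
have dotx x : dotv xi x = a * (tnth x i : R).
  rewrite /dotv (bigD1 i)//= tnth_mktuple eqxx big1 ?addr0// => j ji.
  by rewrite tnth_mktuple (negbTE ji) mul0r.
have := cp s xi s0.
have -> : normv xi = a.
  by rewrite /normv dotx tnth_mktuple eqxx -expr2 sqrtr_sqr ger0_norm.
under eq_integral do rewrite dotx.
move=> cE.
have mc : measurable_fun setT (fun x : Rd R d => cos (a * (tnth x i : R))).
  apply: measurableT_comp; last first.
    by apply: measurable_funM => //; exact: measurable_tnth.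
  by apply: continuous_measurable_fun; exact: continuous_cos.
have ip : (lebesgue_Rd d).-integrable setT (EFin \o p s).
  apply/integrableP; split; first by apply/measurable_EFinP; exact: measurable_stable_density.
  under eq_integral do rewrite /= ger0_norm ?p0//.
  by rewrite integral_stable_density// ltry.
under eq_integral do rewrite mulrBl mul1r EFinB.
rewrite integralB_EFin//.
- by rewrite integral_stable_density// cE.
- apply: le_integrable ip => //.
    apply/measurable_EFinP; apply: measurable_funM => //.
    exact: measurable_stable_density.
  move=> x _ /=; rewrite lee_fin normrM ler_piMl// ler_norml.
  by rewrite cos_geN1 cos_le1.
Qed.

(** Truncation inequality: by the previous averaging bound, the mass where
    rho < |x_i| is at most twice the average of 1 - exp (- s nu a^alpha) over a in
    [0, 2 / rho]. *)
Lemma stable_density_tail (s : R) (i : 'I_d) (rho : R) : 0 < s -> 0 < rho ->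
  (\int[lebesgue_Rd d]_(x in [set x | (rho < `|tnth x i : R|)%R]) (p s x)%:E
    <= (2 * (s * nu * (2 / rho) `^ alpha))%:E)%E.
Proof.
move=> s0 rho0; have [_ p0 _ _] := sp.
pose h := 2 / rho; have h0 : 0 < h by rewrite divr_gt0.
set c := s * nu * _.
have mps := measurable_stable_density s0.
pose f (z : measurableTypeR R * Rd R d) : \bar R :=
  (\1_(`[0, h]%classic : set (measurableTypeR R)) z.1 *
   ((1 - cos ((z.1 : R) * (tnth z.2 i : R))) * p s z.2))%:E.
have f0 z : (0 <= f z)%E.
  by rewrite lee_fin !mulr_ge0// ?p0// subr_ge0 cos_le1.
have mtn : measurable_fun setT (fun z : measurableTypeR R * Rd R d => (tnth z.2 i : R)).
  by apply: (measurableT_comp (measurable_tnth i)) => //; exact: measurable_snd.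
have mfst : measurable_fun setT (fun z : measurableTypeR R * Rd R d => (z.1 : R)).
  exact: measurable_fst.
have mf : measurable_fun setT f.
  apply/measurable_EFinP; apply: measurable_funM.
    have m1 : measurable_fun setT (\1_(`[0, h]%classic : set (measurableTypeR R)) : _ -> R).
      by apply: measurable_indic; exact: measurable_itv.
    exact: (measurableT_comp m1 measurable_fst).
  apply: measurable_funM; last first.
    by apply: (measurableT_comp mps); exact: measurable_snd.
  apply: measurable_funB => //; apply: measurableT_comp; last exact: measurable_funM.
  by apply: continuous_measurable_fun; exact: continuous_cos.
have E1 : (\int[mu]_a \int[lebesgue_Rd d]_x f (a, x) <= (h * c)%:E)%E.
  rewrite (_ : (h * c)%:E = \int[mu]_(a in `[0%R, h]) c%:E)%E; last first.
    rewrite integral_cst//= lebesgue_measure_itv/= lte_fin h0 sube0 muleC.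
    by rewrite EFinM.
  rewrite [leRHS]integral_mkcond; apply: ge0_le_integral => //.
  - by move=> a _; exact: integral_ge0.
  - exact: (measurable_fun_fubini_tonelli_F f).
  - by apply/(measurable_restrictT _ _).1.
  - move=> a _; rewrite patchE; case: ifPn => [|].
      rewrite inE /= in_itv/= => /andP[a0 ah].
      under eq_integral do rewrite /f /= indicE mem_set/= ?in_itv/= ?a0// mul1r.
      rewrite integral_one_minus_cos_stable// lee_fin.
      apply: (@le_trans _ _ (s * nu * a `^ alpha)).
        by have := expR_ge1Dx (- (s * nu * a `^ alpha)); lra.
      rewrite /c ler_pM2l ?mulr_gt0//.
      by rewrite ge0_ler_powR// ?nnegrE ltW.
    rewrite notin_setE => na.
    under eq_integral do rewrite /f /= indicE memNset//= mul0r.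
    by rewrite integral0.
have mB := measurable_coord_gt i rho.
have E2 : ((h / 2)%:E * \int[lebesgue_Rd d]_(x in [set x | (rho < `|tnth x i : R|)%R]) (p s x)%:E
    <= \int[lebesgue_Rd d]_x \int[mu]_a f (a, x))%E.
  rewrite -ge0_integralZl_EFin//; last 3 first.
  - by move=> x _; rewrite lee_fin p0.
  - exact/measurable_EFinP/measurable_funTS.
  - by rewrite ltW// divr_gt0.
  rewrite integral_mkcond; apply: ge0_le_integral => //.
  - move=> x _; rewrite patchE; case: ifP => // _.
    by rewrite -EFinM lee_fin mulr_ge0 ?p0// ltW// divr_gt0.
  - apply/(measurable_restrictT _ _).1 => //; apply: measurable_funTS.
    by apply: emeasurable_funM => //; exact/measurable_EFinP.
  - exact: (measurable_fun_fubini_tonelli_G f).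
  - move=> x _; rewrite patchE; case: ifPn => [|_]; last exact: integral_ge0.
    rewrite inE /= => rx.
    have -> : (\int[mu]_a f (a, x) =
        \int[mu]_(a in `[0%R, h]) ((1 - cos (a * (tnth x i : R)))%:E * (p s x)%:E))%E.
      rewrite [RHS]integral_mkcond; apply: eq_integral => a _.
      rewrite /f patchE indicE /=; case: ifP => _; first by rewrite mul1r EFinM.
      by rewrite mul0r.
    rewrite ge0_integralZr ?lee_fin ?p0//.
    + apply: lee_wpmul2r; first by rewrite lee_fin p0.
      apply: integral_one_minus_cos_ge => //; rewrite /h mulrA ler_pdivlMr// mulrC.
      by rewrite ler_pM2r// ltW.
    + apply/measurable_EFinP; apply: measurable_funB => //.
      apply: measurableT_comp; last exact: measurable_funM.
      by apply: continuous_measurable_fun; exact: continuous_cos.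
have h20 : 0 < h / 2 by rewrite divr_gt0.
rewrite -(@lee_pmul2l _ (h / 2)%:E) ?lte_fin//.
apply: (le_trans E2); rewrite -(fubini_tonelli f)//; apply: (le_trans E1).
by rewrite -EFinM lee_fin; nra.
Qed.

(** The complement of the box is covered by the d one-coordinate tails. *)
Lemma stable_density_box (s rho : R) : 0 < s -> 0 < rho ->
  4 * d%:R * (s * nu * (2 / rho) `^ alpha) <= 1 ->
  ((1 / 2)%:E <= \int[lebesgue_Rd d]_(x in box d rho) (p s x)%:E)%E.
Proof.
move=> s0 rho0 hrho; have [_ p0 _ _] := sp.
set c := s * nu * _ in hrho.
pose tail i := [set x : Rd R d | rho < `|tnth x i : R|].
have mp : measurable_fun setT (fun x => (p s x)%:E).
  by apply/measurable_EFinP; exact: measurable_stable_density.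
have mtail i : measurable (tail i) by exact: measurable_coord_gt.
have mpB (B : set (Rd R d)) : measurable B ->
    measurable_fun setT ((fun x => (p s x)%:E) \_ B).
  by move=> mB; apply/(measurable_restrictT _ _).1 => //; exact: measurable_funTS.
have pB0 (B : set (Rd R d)) x : (0 <= ((fun x => (p s x)%:E) \_ B) x)%E.
  by rewrite patchE; case: ifP => // _; rewrite lee_fin p0.
have le1 : (1 <= \int[lebesgue_Rd d]_(x in box d rho) (p s x)%:E + (2 * d%:R * c)%:E)%E.
  rewrite -(integral_stable_density s0).
  apply: (@le_trans _ _ (\int[lebesgue_Rd d]_(x in box d rho) (p s x)%:E +
      \sum_(i < d) \int[lebesgue_Rd d]_(x in tail i) (p s x)%:E)%E); last first.
    apply: leeD2l; apply: (@le_trans _ _ (\sum_(i < d) (2 * c)%:E)%E).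
      by apply: lee_sum => i _; exact: stable_density_tail.
    by rewrite sumEFin lee_fin sumr_const card_ord -mulr_natr; lra.
  rewrite integral_mkcond [X in (X + _)%E]integral_mkcond.
  under eq_bigr do rewrite integral_mkcond.
  rewrite -ge0_integral_sum//; last by move=> i; exact: mpB.
  rewrite -ge0_integralD; [|by []|by move=> x _; exact: pB0
    |exact: mpB (@measurable_box _ _ _)|by move=> x _; exact: sume_ge0
    |by apply: emeasurable_sum => i; exact: mpB].
  apply: ge0_le_integral => //.
  - exact: mpB.
  - apply: emeasurable_funD; first by apply: mpB; exact: measurable_box.
    by apply: emeasurable_sum => i; exact: mpB.
  - move=> x _; rewrite !patchE in_setT.
    have S0 (Q : pred 'I_d) : (0 <= \sum_(k < d | Q k) ((fun x0 => (p s x0)%:E) \_ (tail k)) x)%E.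
      by apply: sume_ge0 => i _; exact: pB0.
    case: ifPn => [_|]; first by rewrite leeDl.
    rewrite notin_setE /box /= => /existsNP[i /negP]; rewrite -ltNge => xi.
    rewrite add0e (bigD1 i)//= patchE mem_set//.
    by rewrite leeDl.
move: le1; set I := integral _ _ _.
case: I => [r| |].
- by rewrite -EFinD !lee_fin; lra.
- by move=> _; exact: leey.
- by [].
Qed.

End stable.

(** * The fundamental solution *)

Section heat_kernel_theory.
Context {R : realType}.
Variables (d : nat) (nu alpha beta : R) (p : R -> Rd R d -> R) (g : R -> R).
Hypotheses (nu0 : 0 < nu) (alpha0 : 0 < alpha) (beta0 : 0 < beta) (d0 : (0 < d)%N).
Hypothesis sp : stable_density nu alpha p.
Hypothesis sg : subordinator_density beta g.
Local Notation mu := (@lebesgue_measure R).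
Local Notation pos := (`]0, +oo[%classic : set (measurableTypeR R)).
Local Notation f := (inverse_subordinator_density beta g).

Let mpos : measurable pos. Proof. exact: measurable_itv. Qed.

Let g_pos : measurableTypeR R -> R := g \_ pos.

Let measurable_g_pos : measurable_fun setT g_pos.
Proof. by have [mg _ _] := sg; apply/(measurable_restrictT _ _).1. Qed.

Let g_pos_ge0 a : 0 <= g_pos a.
Proof.
have [_ g0 _] := sg; rewrite /g_pos patchE; case: ifPn => //.
by rewrite inE /= in_itv/= andbT => /g0.
Qed.

Let phi_gt0 (t s : R) : 0 < t -> 0 < s -> 0 < t * s `^ (- beta^-1).
Proof. by move=> t0 s0; rewrite mulr_gt0// powR_gt0. Qed.

Let fE (t s : R) : 0 < t -> 0 < s ->
  f t s = g_pos (t * s `^ (- beta^-1)) * (t * beta^-1 * s `^ (- 1 - beta^-1)).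
Proof.
move=> t0 s0; rewrite /inverse_subordinator_density /g_pos patchE mem_set.
  by rewrite mulrC.
by rewrite /= in_itv/= andbT phi_gt0.
Qed.

Let f_ge0 (t s : R) : 0 < t -> 0 < s -> 0 <= f t s.
Proof.
by move=> t0 s0; rewrite fE// !mulr_ge0 ?powR_ge0 ?g_pos_ge0// ?invr_ge0 ltW.
Qed.

Let measurable_f (t : R) : 0 < t -> measurable_fun pos (f t : measurableTypeR R -> R).
Proof.
move=> t0; apply: (eq_measurable_fun (fun s : measurableTypeR R =>
    g_pos (t * s `^ (- beta^-1)) * (t * beta^-1 * s `^ (- 1 - beta^-1)))).
  by move=> s; rewrite inE /= in_itv/= andbT => s0; rewrite fE.
apply: measurable_funTS; apply: measurable_funM.
  apply: (measurableT_comp measurable_g_pos).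
  by apply: measurable_funM => //; exact: measurable_powR.
by apply: measurable_funM => //; exact: measurable_powR.
Qed.

(** The density [f t] of the inverse subordinator is the image of [g] under the
    inverse of s |-> t s^(-1/beta). *)
Let integral_f_comp (t : R) (k : R -> R) : 0 < t -> measurable_fun setT k ->
  (forall a, 0 <= k a) ->
  (\int[mu]_(s in pos) ((k (t * s `^ (- beta^-1)))%:E * (f t s)%:E) =
   \int[mu]_(a in pos) (k a * g a)%:E)%E.
Proof.
move=> t0 mk k0.
transitivity (\int[mu]_(a in pos) (k a * g_pos a)%:E)%E; last first.
  by apply: eq_integral => a apos; rewrite /g_pos patchE apos.
rewrite -(@ge0_integral_powR_subst R t beta^-1 t0 _ (fun a => (k a * g_pos a)%:E)).
- apply: eq_integral => s; rewrite inE /= in_itv/= andbT => s0.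
  by rewrite fE//= -!EFinM !mulrA.
- by rewrite invr_gt0.
- by apply/measurable_EFinP; exact: measurable_funM.
- by move=> a; rewrite lee_fin mulr_ge0.
Qed.

Let integral_laplace (l : R) : 0 <= l ->
  (\int[mu]_(a in pos) (expR (- (l * a)) * g a)%:E = (expR (- (l `^ beta)))%:E)%E.
Proof. by have [_ _ h] := sg; exact: h. Qed.

Let integral_g : (\int[mu]_(a in pos) (g a)%:E = 1)%E.
Proof.
have := integral_laplace (lexx 0).
rewrite powR0 ?gt_eqF// oppr0 expR0 => <-.
by apply: eq_integral => a _; rewrite mul0r oppr0 expR0 mul1r.
Qed.

Let integral_f (t : R) : 0 < t -> (\int[mu]_(s in pos) (f t s)%:E = 1)%E.
Proof.
move=> t0; have := @integral_f_comp t (cst 1) t0.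
under eq_integral do rewrite mul1e.
move=> ->//; rewrite -integral_g.
by apply: eq_integral => a _; rewrite mul1r.
Qed.

(** From 1 - exp (- a) <= 1_(a > 1/4) + 1/4 and the Laplace transform at 1. *)
Let integral_g_tail : ((1 / 4)%:E <=
  \int[mu]_(a in pos) (\1_(`]4^-1, +oo[%classic : set R) a * g a)%:E)%E.
Proof.
have [mg g0 _] := sg.
have gp (a : R) : pos a -> 0 <= g a by rewrite /= in_itv/= andbT => /g0.
set I := (\int[mu]_(a in pos) _)%E.
have m1 : measurable_fun pos (\1_(`]4^-1, +oo[%classic : set R) : measurableTypeR R -> R).
  by apply: measurable_indic; exact: measurable_itv.
have : (1 <= I + ((1 / 4)%:E + (expR (- 1))%:E))%E.
  rewrite -[leLHS]integral_g.
  have -> : ((1 / 4)%:E = \int[mu]_(a in pos) ((1/4)%:E * (g a)%:E))%E.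
    rewrite ge0_integralZl_EFin; [by rewrite integral_g mule1|by []
      |by move=> a /gp; rewrite lee_fin|exact/measurable_EFinP|by []].
  have -> : expR (-1) = expR (- (1 `^ beta)) :> R by rewrite powR1.
  rewrite -(integral_laplace ler01).
  rewrite -ge0_integralD; [|by []| | | |]; last 4 first.
  - by move=> a /gp h; rewrite -EFinM lee_fin mulr_ge0.
  - by apply: emeasurable_funM => //; exact/measurable_EFinP.
  - by move=> a /gp h; rewrite lee_fin mulr_ge0 ?expR_ge0.
  - apply/measurable_EFinP; apply: measurable_funM => //.
    by apply: measurable_funTS; apply: measurableT_comp => //; exact: measurable_funN.
  rewrite -ge0_integralD; [|by []| | | |]; last 4 first.
  - by move=> a /gp h; rewrite lee_fin mulr_ge0.
  - by apply/measurable_EFinP; exact: measurable_funM.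
  - by move=> a /gp h; rewrite adde_ge0// -?EFinM lee_fin mulr_ge0 ?expR_ge0.
  - apply: emeasurable_funD; first by apply: emeasurable_funM => //; exact/measurable_EFinP.
    apply/measurable_EFinP; apply: measurable_funM => //.
    by apply: measurable_funTS; apply: measurableT_comp => //; exact: measurable_funN.
  apply: ge0_le_integral; first by [].
  - by move=> a /gp; rewrite lee_fin.
  - exact/measurable_EFinP.
  - apply: emeasurable_funD; first by apply/measurable_EFinP; exact: measurable_funM.
    apply: emeasurable_funD; first by apply: emeasurable_funM => //; exact/measurable_EFinP.
    apply/measurable_EFinP; apply: measurable_funM => //.
    by apply: measurable_funTS; apply: measurableT_comp => //; exact: measurable_funN.
  move=> a ap; have ga := gp _ ap; move: ap; rewrite /= in_itv/= andbT => a0.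
  rewrite -EFinM -!EFinD lee_fin -!mulrDl ler_peMl//.
  rewrite indicE; have [a4|a4] := ltP (4^-1) a.
    by rewrite mem_set/= ?in_itv/= ?a4//; have := expR_ge0 (- (1 * a)); lra.
  rewrite memNset/=; last by rewrite in_itv/= andbT; apply/negP; rewrite -leNgt.
  have := expR_ge1Dx (- (1 * a)); lra.
have e1 : expR (- 1) <= 1 / 2 :> R.
  rewrite expRN div1r lef_pV2 ?posrE ?expR_gt0//.
  by have := expR_ge1Dx (1 : R); lra.
have I0 : (0 <= I)%E by apply: integral_ge0 => a /gp h; rewrite lee_fin mulr_ge0.
move: I0; case: (I) => [r| |] //; last by move=> _ _; exact: leey.
by rewrite -!EFinD !lee_fin; lra.
Qed.

(** The level t s^(-1/beta) exceeds 1/4 exactly when s < (4 t)^beta. *)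
Let integral_f_head (t : R) : 0 < t ->
  ((1 / 4)%:E <= \int[mu]_(s in pos) ((f t s)%:E *
     (\1_(`]-oo, (4 * t) `^ beta]%classic : set R) s)%:E))%E.
Proof.
move=> t0; apply: (le_trans integral_g_tail).
rewrite -(integral_f_comp t0)//.
have mphi : measurable_fun pos (fun s : measurableTypeR R => t * s `^ (- beta^-1)).
  by apply: measurable_funTS; apply: measurable_funM => //; exact: measurable_powR.
have mi : measurable_fun setT (\1_(`]4^-1, +oo[%classic : set R) : measurableTypeR R -> R).
  by apply: measurable_indic; exact: measurable_itv.
apply: ge0_le_integral; first by [].
- move=> s; rewrite /= in_itv/= andbT => s0.
  by rewrite mule_ge0 ?lee_fin// f_ge0.
- apply: emeasurable_funM; last by apply/measurable_EFinP; exact: measurable_f.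
  by apply/measurable_EFinP; exact: (measurableT_comp mi).
- apply: emeasurable_funM; first by apply/measurable_EFinP; exact: measurable_f.
  by apply/measurable_EFinP/measurable_indic; exact: measurable_itv.
- move=> s; rewrite /= in_itv/= andbT => s0.
  rewrite [leRHS]muleC; apply: lee_wpmul2r; first by rewrite lee_fin f_ge0.
  rewrite lee_fin !indicE ler_nat.
  have [|] := leP s ((4 * t) `^ beta) => h.
    by rewrite [in X in (_ <= X)%N]mem_set /= ?in_itv// leq_b1.
  rewrite memNset//= in_itv/= andbT; apply/negP; rewrite -leNgt.
  rewrite powRN ler_pdivrMr ?powR_gt0//.
  suff : 4 * t <= s `^ beta^-1 by lra.
  have -> : 4 * t = ((4 * t) `^ beta) `^ beta^-1.
    by rewrite -powRrM mulfV ?gt_eqF// powRr1// mulr_ge0// ltW.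
  by rewrite ge0_ler_powR// ?nnegrE ?invr_ge0 ?powR_ge0// ltW.
Qed.

(** The kernel before it is truncated to a real value; it is finite almost
    everywhere since it has total mass 1. *)
Definition heat_kernel_ext (t : R) (x : Rd R d) : \bar R :=
  (\int[mu]_(s in pos) (p s x * f t s)%:E)%E.
Local Notation H := heat_kernel_ext.

Let K (t : R) : measurableTypeR R * Rd R d -> \bar R :=
  (fun z => (p z.1 z.2 * f t z.1)%:E) \_ (pos `*` setT).

Let K_ge0 t z : 0 < t -> (0 <= K t z)%E.
Proof.
have [_ p0 _ _] := sp.
move=> t0; rewrite /K patchE; case: ifPn => //; rewrite inE /= in_itv/= andbT => -[z0 _].
by rewrite lee_fin mulr_ge0 ?p0 ?f_ge0.
Qed.

Let measurable_K t : 0 < t -> measurable_fun setT (K t).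
Proof.
have [mp _ _ _] := sp; move=> t0.
apply/(measurable_restrictT _ _).1; first exact: measurableX.
apply/measurable_EFinP; apply: measurable_funM => //.
apply: (measurable_comp mpos _ (measurable_f t0)).
  by move=> _ [[s x] /= [? _] <-].
exact: measurable_funTS measurable_fst.
Qed.

Let HE t x : H t x = (\int[mu]_s K t (s, x))%E.
Proof.
rewrite /H integral_mkcond; apply: eq_integral => s _; rewrite /K !patchE /=.
by congr (if _ then _ else _); apply/idP/idP; rewrite !inE => //= -[].
Qed.

Lemma heat_kernel_ext_ge0 t x : 0 < t -> (0 <= H t x)%E.
Proof. by move=> t0; rewrite HE; apply: integral_ge0 => s _; exact: K_ge0. Qed.

Lemma measurable_heat_kernel_ext t : 0 < t -> measurable_fun setT (H t).
Proof.
move=> t0; have -> : H t = fun x => (\int[mu]_s K t (s, x))%E.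
  by apply/funext => x; exact: HE.
apply: (measurable_fun_fubini_tonelli_G (K t)); first exact: measurable_K.
by move=> z; exact: K_ge0.
Qed.

Lemma integral_heat_kernel_ext t (B : set (Rd R d)) : 0 < t -> measurable B ->
  (\int[lebesgue_Rd d]_(x in B) H t x =
   \int[mu]_(s in pos) ((f t s)%:E * \int[lebesgue_Rd d]_(x in B) (p s x)%:E))%E.
Proof.
have [_ p0 _ _] := sp; move=> t0 mB.
pose KB (z : measurableTypeR R * Rd R d) := (K t z * (\1_B z.2)%:E)%E.
have mKB : measurable_fun setT KB.
  apply: emeasurable_funM; first exact: measurable_K.
  apply/measurable_EFinP.
  have m1 : measurable_fun setT (\1_B : _ -> R) by exact: measurable_indic.
  exact: (measurableT_comp m1 measurable_snd).
have KB0 z : (0 <= KB z)%E by rewrite mule_ge0 ?K_ge0// lee_fin.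
transitivity (\int[lebesgue_Rd d]_x \int[mu]_s KB (s, x))%E.
  rewrite integral_mkcond; apply: eq_integral => x _.
  rewrite patchE /KB /= indicE; case: ifPn => xB.
    by rewrite HE; apply: eq_integral => s _; rewrite mule1.
  by rewrite integral0_eq// => s _; rewrite mule0.
rewrite -(fubini_tonelli KB)// [RHS]integral_mkcond; apply: eq_integral => s _.
rewrite patchE; case: ifPn => [|]; last first.
  rewrite notin_setE => ns; apply: integral0_eq => x _.
  by rewrite /KB /K patchE memNset ?mul0e// => -[].
rewrite inE => s0; have s0' : 0 < s by move: s0; rewrite /= in_itv/= andbT.
have mps := measurable_stable_density sp s0'.
rewrite -ge0_integralZl_EFin//; last 3 first.
- by move=> x _; rewrite lee_fin p0.
- exact/measurable_EFinP/measurable_funTS.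
- exact: f_ge0.
rewrite [RHS]integral_mkcond; apply: eq_integral => x _.
rewrite /KB /K !patchE /= indicE mem_set//.
by case: ifPn => xB; rewrite ?mule0// mule1 -EFinM mulrC.
Qed.

Lemma integral_heat_kernel_ext1 t : 0 < t -> (\int[lebesgue_Rd d]_x H t x = 1)%E.
Proof.
move=> t0; rewrite integral_heat_kernel_ext// -(integral_f t0).
apply: eq_integral => s; rewrite inE /= in_itv/= andbT => s0.
by rewrite (integral_stable_density alpha0 sp s0) mule1.
Qed.

Local Notation G := (heat_kernel beta p g).

Lemma heat_kernel_ge0 t x : 0 < t -> 0 <= G t x.
Proof. by move=> t0; rewrite fine_ge0//; exact: heat_kernel_ext_ge0. Qed.

Lemma measurable_heat_kernel t : 0 < t -> measurable_fun setT (G t).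
Proof.
move=> t0; have -> : G t = fine \o H t by [].
by apply: measurableT_comp; [exact: fine_measurable|exact: measurable_heat_kernel_ext].
Qed.

Let integral_G t (B : set (Rd R d)) : 0 < t -> measurable B ->
  (\int[lebesgue_Rd d]_(x in B) (G t x)%:E = \int[lebesgue_Rd d]_(x in B) H t x)%E.
Proof.
move=> t0 mB; have iH : (lebesgue_Rd d).-integrable setT (H t).
  apply/integrableP; split; first exact: measurable_heat_kernel_ext.
  under eq_integral => x _ do rewrite gee0_abs ?heat_kernel_ext_ge0//.
  by rewrite integral_heat_kernel_ext1// ltry.
apply: ge0_ae_eq_integral => //.
- by apply/measurable_EFinP; apply: measurable_funTS; exact: measurable_heat_kernel.
- by apply: measurable_funTS; exact: measurable_heat_kernel_ext.
- by move=> x _; rewrite lee_fin heat_kernel_ge0.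
- by move=> x _; exact: heat_kernel_ext_ge0.
- have := integrable_ae measurableT iH; apply: filterS => x /= /(_ I) fH _.
  by rewrite -[RHS]fineK.
Qed.

Lemma integral_heat_kernel t : 0 < t -> (\int[lebesgue_Rd d]_x (G t x)%:E = 1)%E.
Proof. by move=> t0; rewrite integral_G// integral_heat_kernel_ext1. Qed.

(** Mass at least 1/8 of G_t lies in a box of radius rho = 2 k t^(beta/alpha):
    with probability at least 1/4 the inverse subordinator stays below
    (4 t)^beta, and k is chosen so that up to this time the stable process is in
    the box with probability at least 1/2. Cauchy-Schwarz on the box, whose volume
    is of order t^(beta d/alpha), gives the bound. *)
Lemma integral_heat_kernel_sqr : exists2 C : R, 0 < C & forall t, 0 < t ->
  ((C * t `^ (- (beta * d%:R / alpha)))%:E <= \int[lebesgue_Rd d]_x (G t x ^+ 2)%:E)%E.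
Proof.
have [_ p0 _ _] := sp.
have dR0 : 0 < d%:R :> R by rewrite ltr0n.
pose k : R := (4 * d%:R * nu * 4 `^ beta) `^ alpha^-1.
have k0 : 0 < k by rewrite powR_gt0// !mulr_gt0// powR_gt0.
exists ((1 / 8) ^+ 2 / (4 * k) ^+ d).
  by rewrite divr_gt0// exprn_gt0// mulr_gt0.
move=> t t0.
pose rho := 2 * k * t `^ (beta / alpha).
have rho0 : 0 < rho by rewrite !mulr_gt0// powR_gt0.
have tb0 : 0 < t `^ (beta / alpha) by rewrite powR_gt0.
pose M := (4 * t) `^ beta.
have M0 : 0 < M by rewrite powR_gt0// mulr_gt0.
have hrho : 4 * d%:R * (M * nu * (2 / rho) `^ alpha) = 1.
  have -> : 2 / rho = (k * t `^ (beta / alpha))^-1.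
    by rewrite /rho; field; rewrite !gt_eqF.
  have -> : ((k * t `^ (beta / alpha))^-1) `^ alpha =
      (4 * d%:R * nu * 4 `^ beta * t `^ beta)^-1.
    rewrite -powR_inv1 ?mulr_ge0 ?ltW// -powRrM mulN1r powRN powRM ?ltW//.
    rewrite /k -!powRrM mulVf ?gt_eqF// mulfVK ?gt_eqF// powRr1//.
    by rewrite !mulr_ge0 ?powR_ge0// ltW.
  rewrite /M powRM// ?ltW//; field.
  by rewrite !gt_eqF// ?powR_gt0.
have -> : (1 / 8) ^+ 2 / (4 * k) ^+ d * t `^ (- (beta * d%:R / alpha)) =
    (1 / 8) ^+ 2 / (2 * rho) ^+ d.
  have -> : 2 * rho = 4 * k * t `^ (beta / alpha) by rewrite /rho; ring.
  rewrite [(4 * k * _) ^+ d]exprMn powRN.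
  have -> : (t `^ (beta / alpha)) ^+ d = t `^ (beta * d%:R / alpha).
    by rewrite -powR_mulrn ?powR_ge0// -powRrM; congr (_ `^ _); ring.
  by rewrite -[LHS]mulrA -invfM.
apply: (@integral_sqr_ge _ _ _ _ (G t) (box d rho)).
- exact: measurable_heat_kernel.
- by move=> x; exact: heat_kernel_ge0.
- exact: measurable_box.
- exact: lebesgue_Rd_box (ltW rho0).
- by rewrite exprn_gt0// mulr_gt0.
- by rewrite divr_ge0.
rewrite integral_G//; last exact: measurable_box.
rewrite integral_heat_kernel_ext//; last exact: measurable_box.
apply: (@le_trans _ _ (\int[mu]_(s in pos)
  ((1 / 2)%:E * ((f t s)%:E * (\1_(`]-oo, M]%classic : set R) s)%:E)))%E).
  have mi : measurable_fun pos (\1_(`]-oo, M]%classic : set R) : measurableTypeR R -> R).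
    by apply: measurable_indic; exact: measurable_itv.
  rewrite ge0_integralZl_EFin//.
  - apply: (@le_trans _ _ ((1 / 2)%:E * (1 / 4)%:E)%E).
      by rewrite -EFinM lee_fin; lra.
    apply: lee_wpmul2l; first by rewrite lee_fin.
    exact: integral_f_head.
  - move=> s; rewrite /= in_itv/= andbT => s0.
    by rewrite -EFinM lee_fin mulr_ge0// f_ge0.
  - apply: emeasurable_funM; last exact/measurable_EFinP.
    by apply/measurable_EFinP; exact: measurable_f.
have mint : measurable_fun pos (fun s => \int[lebesgue_Rd d]_(x in box d rho) (p s x)%:E)%E.
  have [mp _ _ _] := sp.
  pose q : measurableTypeR R * Rd R d -> \bar R :=
    (fun z => (p z.1 z.2)%:E) \_ (pos `*` box d rho).
  have mq : measurable_fun setT q.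
    apply/(measurable_restrictT _ _).1; first exact: measurableX mpos (measurable_box _).
    apply/measurable_EFinP; apply: measurable_funS mp; first exact: measurableX.
    by move=> z [].
  have q0 z : (0 <= q z)%E.
    rewrite /q patchE; case: ifPn => //; rewrite inE /= in_itv/= andbT => -[z0 _].
    by rewrite lee_fin p0.
  apply: (eq_measurable_fun (fun s => \int[lebesgue_Rd d]_x q (s, x))%E).
    move=> s sp0; rewrite [RHS]integral_mkcond; apply: eq_integral => x _.
    move: sp0; rewrite inE => sp0; rewrite /q !patchE.
    have [xb|xb] := pselect (box d rho x); first by rewrite !mem_set.
    by rewrite !memNset// => -[].
  apply: measurable_funTS.
  exact: (measurable_fun_fubini_tonelli_F q).
apply: ge0_le_integral; first by [].
- move=> s; rewrite /= in_itv/= andbT => s0.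
  rewrite -!EFinM lee_fin; apply: mulr_ge0 => //; apply: mulr_ge0 => //.
  exact: f_ge0.
- apply: emeasurable_funM => //; apply: emeasurable_funM.
    by apply/measurable_EFinP; exact: measurable_f.
  apply/measurable_EFinP; apply: measurable_indic; exact: measurable_itv.
- apply: emeasurable_funM => //; by apply/measurable_EFinP; exact: measurable_f.
move=> s; rewrite /= in_itv/= andbT => s0.
rewrite muleCA; apply: lee_wpmul2l; first by rewrite lee_fin f_ge0.
rewrite indicE; case: (boolP (_ \in _)) => [|_]; last first.
  rewrite mule0; apply: integral_ge0 => x _; by rewrite lee_fin p0.
rewrite inE /= in_itv/= => sM; rewrite mule1.
apply: (stable_density_box nu0 alpha0 sp) => //.
rewrite -[leRHS]hrho; apply: ler_wpM2l; first by rewrite mulr_ge0.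
apply: ler_wpM2r; first exact: powR_ge0.
by apply: ler_wpM2r => //; exact: ltW.
Qed.

End heat_kernel_theory.

(** * Square integrable functions, tensor products and independence *)

Section square_integrable_theory.
Context {d} {T : measurableType d} {R : realType}.
Variable mu : {measure set T -> \bar R}.
Variable D : set T.
Hypothesis mD : measurable D.
Implicit Types f g : T -> R.

Lemma square_integrable_integrable f : square_integrable mu D f ->
  mu.-integrable D (fun x => (f x ^+ 2)%:E).
Proof.
move=> [mf fi]; apply/integrableP; split.
  by apply/measurable_EFinP; exact: measurable_funX.
by under eq_integral do rewrite /= ger0_norm ?sqr_ge0//.
Qed.

Lemma square_integrable_le f g : measurable_fun D f ->
  mu.-integrable D (fun x => (g x)%:E) ->
  (forall x, D x -> f x ^+ 2 <= g x) -> square_integrable mu D f.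
Proof.
move=> mf /integrableP[mg ig] fg; split=> //; apply: le_lt_trans ig.
apply: ge0_le_integral => //.
- by move=> x _; rewrite lee_fin sqr_ge0.
- by apply/measurable_EFinP; exact: measurable_funX.
- by apply: measurableT_comp.
- move=> x Dx; rewrite /= lee_fin; exact: le_trans (fg _ Dx) (ler_norm _).
Qed.

Lemma square_integrableD f g : square_integrable mu D f ->
  square_integrable mu D g -> square_integrable mu D (fun x => f x + g x).
Proof.
move=> sf sg; have [mf _] := sf; have [mg _] := sg.
apply: (@square_integrable_le _ (fun x => 2 * (f x ^+ 2) + 2 * (g x ^+ 2))).
- exact: measurable_funD.
- under eq_fun do rewrite EFinD !EFinM.
  apply: integrableD => //; apply: integrableZl => //; exact: square_integrable_integrable.
- by move=> x _; have := sqr_ge0 (f x - g x); nra.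
Qed.

Lemma square_integrableZ c f : square_integrable mu D f ->
  square_integrable mu D (fun x => c * f x).
Proof.
move=> sf; have [mf _] := sf.
apply: (@square_integrable_le _ (fun x => c ^+ 2 * (f x ^+ 2))).
- exact: measurable_funM.
- under eq_fun do rewrite EFinM.
  by apply: integrableZl => //; exact: square_integrable_integrable.
- by move=> x _; rewrite exprMn.
Qed.

Lemma square_integrable0 : square_integrable mu D (fun=> 0).
Proof.
split => //; under eq_integral do rewrite expr0n /=.
by rewrite integral0 ltry.
Qed.

Lemma square_integrableB f g : square_integrable mu D f ->
  square_integrable mu D g -> square_integrable mu D (fun x => f x - g x).
Proof.
move=> sf sg; rewrite (_ : (fun x => _) = (fun x => f x + (-1) * g x)).
  by apply: square_integrableD => //; exact: square_integrableZ.
by apply/funext => x; rewrite mulN1r.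
Qed.

Lemma square_integrable_sum (I : Type) (s : seq I) (A : I -> T -> R) :
  (forall i, square_integrable mu D (A i)) ->
  square_integrable mu D (fun x => \sum_(i <- s) A i x).
Proof.
move=> hA; elim: s => [|i s IH].
  by under eq_fun do rewrite big_nil; exact: square_integrable0.
by under eq_fun do rewrite big_cons; exact: square_integrableD.
Qed.

Lemma square_integrableM f g : square_integrable mu D f ->
  square_integrable mu D g -> mu.-integrable D (fun x => (f x * g x)%:E).
Proof.
move=> sf sg; have [mf _] := sf; have [mg _] := sg.
apply: (@le_integrable _ _ _ mu D mD _ (fun x => (f x ^+ 2 + g x ^+ 2)%:E)).
- by apply/measurable_EFinP; exact: measurable_funM.
- move=> x _; rewrite /= lee_fin [leRHS]ger0_norm ?addr_ge0 ?sqr_ge0// normrM.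
  rewrite -(real_normK (num_real (f x))) -(real_normK (num_real (g x))).
  by have := sqr_ge0 (`|f x| - `|g x|); have := normr_ge0 (f x); have := normr_ge0 (g x); nra.
- under eq_fun do rewrite EFinD.
  by apply: integrableD => //; exact: square_integrable_integrable.
Qed.

Lemma integral_sqr_sum n (A : 'I_n -> T -> R) :
  (forall i, square_integrable mu D (A i)) ->
  (\int[mu]_(x in D) ((\sum_(i < n) A i x) ^+ 2)%:E =
   \sum_(i < n) \sum_(j < n) \int[mu]_(x in D) (A i x * A j x)%:E)%E.
Proof.
move=> hA; under eq_integral.
  move=> x _; rewrite expr2 mulr_suml -sumEFin.
  under eq_bigr do rewrite mulr_sumr -sumEFin.
  over.
rewrite integral_sum//; last first.
  move=> i; apply: integrable_sum => // j _; exact: square_integrableM.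
apply: eq_bigr => i _; rewrite integral_sum// => j; exact: square_integrableM.
Qed.

End square_integrable_theory.

Section integral_product.
Context d1 d2 (T1 : measurableType d1) (T2 : measurableType d2) (R : realType).
Variable m1 : {sigma_finite_measure set T1 -> \bar R}.
Variable m2 : {sigma_finite_measure set T2 -> \bar R}.

Let integral_tensorT (h : T1 -> R) (k : T2 -> R) :
  m1.-integrable setT (EFin \o h) -> m2.-integrable setT (EFin \o k) ->
  (m1 \x m2)%E.-integrable setT (fun z => (h z.1 * k z.2)%:E) /\
  (\int[m1 \x m2]_z (h z.1 * k z.2)%:E =
   (\int[m1]_x (h x)%:E) * (\int[m2]_y (k y)%:E))%E.
Proof.
move=> ih ik.
have mh : measurable_fun setT h by apply/measurable_EFinP; exact: measurable_int ih.
have mk : measurable_fun setT k by apply/measurable_EFinP; exact: measurable_int ik.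
have mhk : measurable_fun setT (fun z : T1 * T2 => (h z.1 * k z.2)%:E).
  by apply/measurable_EFinP; apply: measurable_funM;
    [exact: (measurableT_comp mh)|exact: (measurableT_comp mk)].
have ihk : (m1 \x m2)%E.-integrable setT (fun z => (h z.1 * k z.2)%:E).
  apply/(integrable12ltyP _ _ mhk) => /=.
  have /integrableP[_ lh] := ih; have /integrableP[_ lk] := ik.
  under eq_integral => x _.
    under eq_integral do rewrite normrM EFinM.
    rewrite ge0_integralZl_EFin//; last first.
      by apply/measurable_EFinP; exact: measurableT_comp.
    over.
  rewrite ge0_integralZr//.
  - apply: lte_mul_pinfty => //; first exact: integral_ge0.
    by rewrite ge0_fin_numE//; exact: integral_ge0.
  - by apply/measurable_EFinP; exact: measurableT_comp.
  - exact: integral_ge0.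
split=> //.
rewrite -integral12_prod_meas1//= /fubini_F.
under eq_integral => x _.
  under eq_integral do rewrite /= EFinM.
  rewrite integralZl//; over.
have fk := integrable_fin_num measurableT ik.
by rewrite -(fineK fk) integralZr.
Qed.

Lemma integral_tensor (D : set T1) (h : T1 -> R) (k : T2 -> R) : measurable D ->
  m1.-integrable D (EFin \o h) -> m2.-integrable setT (EFin \o k) ->
  (m1 \x m2)%E.-integrable (D `*` setT) (fun z => (h z.1 * k z.2)%:E) /\
  (\int[m1 \x m2]_(z in D `*` setT) (h z.1 * k z.2)%:E =
   (\int[m1]_(x in D) (h x)%:E) * (\int[m2]_y (k y)%:E))%E.
Proof.
move=> mD ih ik.
have ih' : m1.-integrable setT (EFin \o (h \_ D)).
  by rewrite -restrict_EFin; apply/(integrable_mkcond _ mD).1.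
have [i1 i2] := integral_tensorT ih' ik.
have E : (fun z : T1 * T2 => (h z.1 * k z.2)%:E) \_ (D `*` setT) =
    (fun z => ((h \_ D) z.1 * k z.2)%:E).
  apply/funext => z; rewrite !patchE.
  have [Dz|Dz] := pselect (D z.1); first by rewrite !mem_set.
  by rewrite !memNset ?mul0r// => -[].
split.
  by apply/(integrable_mkcond _ _).2; [exact: measurableX|rewrite E].
rewrite integral_mkcond E i2; congr (_ * _)%E.
by rewrite [RHS]integral_mkcond; apply: eq_integral => x _; rewrite !patchE; case: ifP.
Qed.

End integral_product.

Section independence.
Context d (T : measurableType d) (R : realType) (P : probability T R).

Definition independent_rv (X Y : T -> R) := forall A B : set R,
  measurable A -> measurable B ->
  P (X @^-1` A `&` Y @^-1` B) = (P (X @^-1` A) * P (Y @^-1` B))%E.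

Lemma independent_rv_comp (X Y : T -> R) (h k : R -> R) :
  measurable_fun setT h -> measurable_fun setT k ->
  independent_rv X Y -> independent_rv (h \o X) (k \o Y).
Proof.
move=> mh mk XY A B mA mB; apply: (XY (h @^-1` A) (k @^-1` B)).
- by rewrite -[X in measurable X]setTI; exact: mh.
- by rewrite -[X in measurable X]setTI; exact: mk.
Qed.

(** The joint law agrees with the product of the two laws on rectangles, hence
    everywhere, and Fubini applies to (x, y) |-> x y. *)
Lemma independent_rvM (X Y : T -> R) : independent_rv X Y ->
  P.-integrable setT (EFin \o X) -> P.-integrable setT (EFin \o Y) ->
  P.-integrable setT (fun w => (X w * Y w)%:E) /\
  (\int[P]_w (X w * Y w)%:E = (\int[P]_w (X w)%:E) * (\int[P]_w (Y w)%:E))%E.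
Proof.
move=> XY iX iY.
have mX : measurable_fun setT X by apply/measurable_EFinP; exact: measurable_int iX.
have mY : measurable_fun setT Y by apply/measurable_EFinP; exact: measurable_int iY.
pose X' : {RV P >-> R} := HB.pack X (isMeasurableFun.Build _ _ _ _ _ mX).
pose Y' : {RV P >-> R} := HB.pack Y (isMeasurableFun.Build _ _ _ _ _ mY).
pose XYf w : R * R := (X w, Y w).
have mXY : measurable_fun setT XYf by exact: measurable_fun_pair.
pose law : {measure set (R * R) -> \bar R} :=
  measure_function_pushforward__canonical__measure_function_Measure P mXY.
have lawE A : measurable A ->
    (distribution P X' \x distribution P Y')%E A = law A.
  by apply: product_measure_unique => B C mB mC; exact: XY.
have iX' : (distribution P X').-integrable setT (EFin \o (id : R -> R)).
  by apply: integrable_pushforward => //; exact/measurable_EFinP.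
have iY' : (distribution P Y').-integrable setT (EFin \o (id : R -> R)).
  by apply: integrable_pushforward => //; exact/measurable_EFinP.
have [i1 i2] := integral_tensor measurableT iX' iY'.
rewrite setXTT in i1 i2.
have mm : measurable_fun setT (fun z : R * R => (z.1 * z.2)%:E).
  exact: measurable_int i1.
have iXY : P.-integrable setT (fun w => (X w * Y w)%:E).
  apply/integrableP; split; first by apply/measurable_EFinP; exact: measurable_funM.
  have /integrableP[_] := i1.
  rewrite (eq_measure_integral law) => [|A mA _]; last exact: lawE.
  rewrite ge0_integral_pushforward//; exact: measurableT_comp.
split=> //.
rewrite (_ : \int[P]_w (X w)%:E = \int[distribution P X']_x x%:E)%E; last first.
  by rewrite integral_pushforward//; exact/measurable_EFinP.
rewrite (_ : \int[P]_w (Y w)%:E = \int[distribution P Y']_x x%:E)%E; last first.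
  by rewrite integral_pushforward//; exact/measurable_EFinP.
rewrite -i2 (eq_measure_integral law) => [|A mA _]; last exact: lawE.
by rewrite integral_pushforward.
Qed.

End independence.

(** * White noise *)

Section symmetric_mean.
Context {R : realType} {d} {T : measurableType d} (P : probability T R).

Lemma normal_prob_oppr (s : R) (B : set R) : 0 < s -> measurable B ->
  normal_prob 0 s (-%R @^-1` B) = normal_prob 0 s B.
Proof.
move=> s0 mB.
have mNB : measurable (-%R @^-1` B : set R).
  by rewrite -[X in measurable X]setTI; exact: oppr_measurable.
have mpdf := measurable_normal_pdf 0 s.
rewrite /normal_prob integral_mkcond [RHS]integral_mkcond.
rewrite -(ge0_integral_reflect 0 (f := (fun x => (normal_pdf 0 s x)%:E) \_ B)).
- apply: eq_integral => x _; rewrite !patchE sub0r.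
  have -> : (x \in -%R @^-1` B) = (- x \in B) by apply/idP/idP; rewrite !inE.
  case: ifP => // _; congr EFin; rewrite /normal_pdf gt_eqF//.
  change (normal_peak s * normal_fun 0 s x = normal_peak s * normal_fun 0 s (- x)).
  by rewrite /normal_fun !subr0 sqrrN.
- apply/(measurable_restrictT _ _).1 => //.
  by apply/measurable_EFinP; exact: measurable_funTS.
- by move=> x; rewrite patchE; case: ifP => // _; rewrite lee_fin normal_pdf_ge0.
Qed.

Lemma integral_symmetric (X : T -> R) : P.-integrable setT (EFin \o X) ->
  (forall B : set R, measurable B -> P (X @^-1` (-%R @^-1` B)) = P (X @^-1` B)) ->
  (\int[P]_w (X w)%:E = 0)%E.
Proof.
move=> iX symX.
have mX : measurable_fun setT X by apply/measurable_EFinP; exact: measurable_int iX.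
have mNX : measurable_fun setT (\- X) by exact: measurable_funN.
pose X' : {RV P >-> R} := HB.pack X (isMeasurableFun.Build _ _ _ _ _ mX).
pose NX' : {RV P >-> R} := HB.pack (\- X) (isMeasurableFun.Build _ _ _ _ _ mNX).
have iNX : P.-integrable setT (EFin \o (\- X)).
  by have := integrableN iX; apply: eq_integrable => // x _; rewrite /= EFinN.
have E : (\int[P]_w (X w)%:E = \int[P]_w (- X w)%:E)%E.
  transitivity (\int[distribution P X']_x x%:E)%E.
    by rewrite integral_pushforward//; exact/measurable_EFinP.
  transitivity (\int[distribution P NX']_x x%:E)%E.
    by apply: eq_measure_integral => B mB _; exact/esym/symX.
  by rewrite integral_pushforward//; exact/measurable_EFinP.
have fX := integrable_fin_num measurableT iX.
move: E; under [X in _ = X -> _]eq_integral do rewrite EFinN.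
rewrite (@integralN _ _ _ P setT (EFin \o X)) /=; last first.
  by apply: integrable_add_def.
move: fX => /=; case: (integral _ _ _) => //= r _ [] h; congr EFin; lra.
Qed.

Lemma centered_gaussian_mean (X : T -> R) : P.-integrable setT (EFin \o X) ->
  centered_gaussian P X -> (\int[P]_w (X w)%:E = 0)%E.
Proof.
move=> iX [mX [X0|[s s0 hs]]].
  rewrite (ae_eq_integral (cst 0%E))//= ?integral0//; first exact/measurable_EFinP.
  by apply: filterS X0 => w /= -> _.
apply: integral_symmetric => // B mB; rewrite !hs ?normal_prob_oppr//.
by rewrite -[X in measurable X]setTI; exact: oppr_measurable.
Qed.

End symmetric_mean.

Lemma square_integrable_prob {R : realType} {d} {T : measurableType d}
    (P : probability T R) (X : T -> R) :
  square_integrable P setT X -> P.-integrable setT (EFin \o X).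
Proof.
move=> sX; have s1 : square_integrable P setT (cst 1 : T -> R).
  split=> //; under eq_integral do rewrite expr1n.
  by rewrite integral_cst//= probability_setT mule1 ltry.
have := square_integrableM measurableT sX s1.
by apply: eq_integrable => // w _; rewrite mulr1.
Qed.

Section measurable_wrt_theory.
Context {R : realType} {d} {T : measurableType d} (G : set (set T)).
Hypothesis sG : sigma_algebra setT G.

Lemma measurable_wrtP (X : T -> R) : measurable_wrt G X <->
  measurable_fun setT (X : g_sigma_algebraType G -> R).
Proof.
split=> [h _ B mB|h B mB].
  by rewrite setTI /measurable /= sigma_algebra_id//; exact: h.
by have := h measurableT B mB; rewrite setTI /measurable /= sigma_algebra_id.
Qed.

Lemma measurable_wrtM (X Y : T -> R) : measurable_wrt G X ->
  measurable_wrt G Y -> measurable_wrt G (fun w => X w * Y w).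
Proof.
move=> /measurable_wrtP mX /measurable_wrtP mY; apply/measurable_wrtP.
exact: measurable_funM.
Qed.

End measurable_wrt_theory.

Section white_noise_theory.
Context {R : realType} {disp : measure_display} {Omega : measurableType disp}.
Variables (P : probability Omega R) (d : nat) (F : R -> set (set Omega)).
Variable W : (measurableTypeR R * Rd R d -> R) -> Omega -> R.
Hypotheses (FF : filtration P F) (wn : white_noise P F W).
Local Notation half := (@halfspace R d).
Local Notation L2 := (@L2_halfspace R d).
Implicit Types f g h : measurableTypeR R * Rd R d -> R.

Lemma measurable_halfspace : measurable half.
Proof. by apply: measurableX => //; exact: measurable_itv. Qed.
Let mhalf : measurable half. Proof. exact: measurable_halfspace. Qed.

Lemma noise_gaussian f : L2 f -> centered_gaussian P (W f).
Proof.
move=> Lf; have [h _ _ _] := wn; have := h 1%N (fun=> 1) (fun=> f) (fun=> Lf).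
by congr (centered_gaussian P _); apply/funext => w; rewrite big_ord1 mul1r.
Qed.

Lemma measurable_noise f : L2 f -> measurable_fun setT (W f).
Proof. by move=> /noise_gaussian[]. Qed.

Lemma noise_covariance f g : L2 f -> L2 g ->
  (\int[P]_w (W f w * W g w)%:E = \int[dtdx d]_(z in half) (f z * g z)%:E)%E.
Proof. by move=> Lf Lg; have [_ h _ _] := wn; have := h f g Lf Lg; rewrite unlock. Qed.

Lemma square_integrable_noise f : L2 f -> square_integrable P setT (W f).
Proof.
move=> Lf; split; first exact: measurable_noise.
under eq_integral do rewrite expr2.
rewrite noise_covariance//; have [_] := Lf.
by under eq_integral do rewrite expr2.
Qed.

Lemma noise_mean f : L2 f -> (\int[P]_w (W f w)%:E = 0)%E.
Proof.
move=> Lf; apply: centered_gaussian_mean; last exact: noise_gaussian.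
exact: square_integrable_prob (square_integrable_noise Lf).
Qed.

(** The isometry f |-> W(f) on linear combinations; with it an a.s. linear
    relation between the W(f_i) follows from an a.e. relation between the f_i. *)
Lemma noise_comb_sqr n (c : 'I_n -> R) (f : 'I_n -> measurableTypeR R * Rd R d -> R) :
  (forall i, L2 (f i)) ->
  (\int[P]_w ((\sum_(i < n) c i * W (f i) w) ^+ 2)%:E =
   \int[dtdx d]_(z in half) ((\sum_(i < n) c i * f i z) ^+ 2)%:E)%E.
Proof.
move=> Lf.
rewrite integral_sqr_sum//; last first.
  by move=> i; apply: square_integrableZ => //; exact: square_integrable_noise.
rewrite integral_sqr_sum//; last first.
  by move=> i; exact: (square_integrableZ mhalf (c i) (Lf i)).
apply: eq_bigr => i _; apply: eq_bigr => j _.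
under eq_integral do rewrite mulrACA EFinM.
rewrite integralZl//; last first.
  by apply: square_integrableM => //; exact: square_integrable_noise.
under [RHS]eq_integral do rewrite mulrACA EFinM.
rewrite integralZl ?noise_covariance//.
exact: (square_integrableM mhalf (Lf i) (Lf j)).
Qed.

Lemma noise_comb_eq0 n (c : 'I_n -> R) (f : 'I_n -> measurableTypeR R * Rd R d -> R) :
  (forall i, L2 (f i)) ->
  (\int[dtdx d]_(z in half) ((\sum_(i < n) c i * f i z) ^+ 2)%:E = 0)%E ->
  {ae P, forall w, \sum_(i < n) c i * W (f i) w = 0}.
Proof.
move=> Lf; rewrite -noise_comb_sqr// => E0.
have ms : measurable_fun setT (fun w => \sum_(i < n) c i * W (f i) w).
  apply: measurable_sum => i; apply: measurable_funM => //; exact: measurable_noise.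
pose S w : \bar R := ((\sum_(i < n) c i * W (f i) w) ^+ 2)%:E.
have mS : measurable_fun setT S by apply/measurable_EFinP; exact: measurable_funX.
have /(ae_eq_integral_abs P measurableT mS) : (\int[P]_w `|S w| = 0)%E.
  by rewrite -[RHS]E0; apply: eq_integral => w _; rewrite gee0_abs// lee_fin sqr_ge0.
apply: filterS => w /= /(_ I) /eqP; rewrite eqe sqrf_eq0 => /eqP.
by [].
Qed.

End white_noise_theory.

Definition vanish_until {R : realType} d (t : R)
    (f : measurableTypeR R * Rd R d -> R) :=
  forall z, 0 < (z.1 : R) -> (z.1 : R) <= t -> f z = 0.

Definition halfspace_dot {R : realType} d (f g : measurableTypeR R * Rd R d -> R) :=
  (\int[dtdx d]_(z in @halfspace R d) (f z * g z)%:E)%E.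

Section filtration_theory.
Context {R : realType} {disp : measure_display} {Omega : measurableType disp}.
Variables (P : probability Omega R) (F : R -> set (set Omega)).
Hypothesis FF : filtration P F.
Implicit Types (X : Omega -> R).

Lemma filtration_sigma_algebra t : 0 <= t -> sigma_algebra setT (F t).
Proof. by move=> t0; have [h _ _ _] := FF; have [] := h t t0. Qed.

Lemma measurable_wrt_filtration t X : 0 <= t -> measurable_wrt (F t) X ->
  measurable_fun setT X.
Proof.
move=> t0 mX _ B mB; rewrite setTI; have [h _ _ _] := FF; have [_] := h t t0.
by apply; exact: mX.
Qed.

Lemma measurable_wrt_le s t X : 0 <= s -> s <= t ->
  measurable_wrt (F s) X -> measurable_wrt (F t) X.
Proof. by move=> s0 st mX B mB; have [_ h _ _] := FF; apply: (h s t s0 st); exact: mX. Qed.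

End filtration_theory.

Section white_noise_isometry.
Context {R : realType} {disp : measure_display} {Omega : measurableType disp}.
Variables (P : probability Omega R) (d : nat) (F : R -> set (set Omega)).
Variable W : (measurableTypeR R * Rd R d -> R) -> Omega -> R.
Hypotheses (FF : filtration P F) (wn : white_noise P F W).
Local Notation half := (@halfspace R d).
Local Notation L2 := (@L2_halfspace R d).
Implicit Types f g h : measurableTypeR R * Rd R d -> R.

Let mhalf : measurable half. Proof. exact: measurable_halfspace. Qed.

Local Notation ip := (@halfspace_dot R d).

Lemma noiseD h f g : L2 h -> L2 f -> L2 g ->
  (\int[dtdx d]_(z in half) ((h z - f z - g z) ^+ 2)%:E = 0)%E ->
  {ae P, forall w, W h w = W f w + W g w}.
Proof.
move=> Lh Lf Lg h0.
pose c (i : 'I_3) : R := if i == 0 :> nat then 1 else -1.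
pose e (i : 'I_3) := if i == 0 :> nat then h else if i == 1 :> nat then f else g.
have Le i : L2 (e i) by rewrite /e; case: ifP => // _; case: ifP.
have E0 : (\int[dtdx d]_(z in half) ((\sum_(i < 3) c i * e i z) ^+ 2)%:E = 0)%E.
  rewrite -[RHS]h0; apply: eq_integral => z _.
  by rewrite !big_ord_recl big_ord0 /c /e /=; congr EFin; ring.
apply: filterS (noise_comb_eq0 wn Le E0) => w; rewrite !big_ord_recl big_ord0 /c /e /=; lra.
Qed.

Lemma noise_ae_eq f g : L2 f -> L2 g ->
  (\int[dtdx d]_(z in half) ((f z - g z) ^+ 2)%:E = 0)%E ->
  {ae P, forall w, W f w = W g w}.
Proof.
move=> Lf Lg h0.
pose c (i : 'I_2) : R := if i == 0 :> nat then 1 else -1.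
pose e (i : 'I_2) := if i == 0 :> nat then f else g.
have Le i : L2 (e i) by rewrite /e; case: ifP.
have E0 : (\int[dtdx d]_(z in half) ((\sum_(i < 2) c i * e i z) ^+ 2)%:E = 0)%E.
  rewrite -[RHS]h0; apply: eq_integral => z _.
  by rewrite !big_ord_recl big_ord0 /c /e /=; congr EFin; ring.
apply: filterS (noise_comb_eq0 wn Le E0) => w; rewrite !big_ord_recl big_ord0 /c /e /=; lra.
Qed.

Lemma noise_independent t f X : 0 <= t -> L2 f -> vanish_until t f ->
  measurable_wrt (F t) X -> independent_rv P X (W f).
Proof.
move=> t0 Lf f0 mX A B mA mB; have [_ _ _ h] := wn.
exact: (h t f t0 Lf f0 _ _ (mX _ mA) mB).
Qed.

(** Martingale property: noise after time t is centered and independent of the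
    past. *)
Lemma integral_adapted_noise t f X : 0 <= t -> L2 f -> vanish_until t f ->
  measurable_wrt (F t) X -> P.-integrable setT (EFin \o X) ->
  P.-integrable setT (fun w => (X w * W f w)%:E) /\
  (\int[P]_w (X w * W f w)%:E = 0)%E.
Proof.
move=> t0 Lf f0 mX iX.
have iW : P.-integrable setT (EFin \o W f).
  exact: square_integrable_prob (square_integrable_noise wn Lf).
have [i1 ->] := independent_rvM (noise_independent t0 Lf f0 mX) iX iW.
by rewrite (noise_mean wn Lf) mule0.
Qed.

Let integral_adapted_noise_sqr t f X : 0 <= t -> L2 f -> vanish_until t f ->
  measurable_wrt (F t) X -> P.-integrable setT (EFin \o X) ->
  P.-integrable setT (fun w => (X w * (W f w) ^+ 2)%:E) /\
  (\int[P]_w (X w * (W f w) ^+ 2)%:E = (\int[P]_w (X w)%:E) * ip f f)%E.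
Proof.
move=> t0 Lf f0 mX iX.
have iW : P.-integrable setT (EFin \o (fun w => W f w ^+ 2)).
  exact: square_integrable_integrable (square_integrable_noise wn Lf).
have ind : independent_rv P X (fun w => W f w ^+ 2).
  apply: (@independent_rv_comp _ _ _ P X (W f) id (fun x => x ^+ 2)) => //.
  exact: noise_independent t0 Lf f0 mX.
have [i1 i2] := independent_rvM ind iX iW.
split=> //; rewrite i2; congr (_ * _)%E.
by rewrite /halfspace_dot -(noise_covariance wn Lf Lf); apply: eq_integral => w _; rewrite expr2.
Qed.

(** Only each single W(f) is known to be independent of the past, not pairs; the
    product W(f) W(g) is reached by polarization, as W(f + g) = W(f) + W(g) a.s. *)
Lemma integral_adapted_noise2 t f g X : 0 <= t -> L2 f -> L2 g ->
  vanish_until t f -> vanish_until t g ->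
  measurable_wrt (F t) X -> P.-integrable setT (EFin \o X) ->
  P.-integrable setT (fun w => (X w * (W f w * W g w))%:E) /\
  (\int[P]_w (X w * (W f w * W g w))%:E = (\int[P]_w (X w)%:E) * ip f g)%E.
Proof.
move=> t0 Lf Lg f0 g0 mX iX.
pose h z := f z + g z.
have Lh : L2 h by exact: square_integrableD.
have h0 : vanish_until t h by move=> z z0 zt; rewrite /h f0// g0// addr0.
have [iff If] := integral_adapted_noise_sqr t0 Lf f0 mX iX.
have [igg Ig] := integral_adapted_noise_sqr t0 Lg g0 mX iX.
have [ihh Ih] := integral_adapted_noise_sqr t0 Lh h0 mX iX.
have mX' := measurable_wrt_filtration FF t0 mX.
have mWf := measurable_noise wn Lf; have mWg := measurable_noise wn Lg.
have Whfg : {ae P, forall w, W h w = W f w + W g w}.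
  apply: noiseD => //.
  rewrite -[RHS](@integral0 _ _ _ (dtdx d) half); apply: eq_integral => z _.
  by rewrite /h (_ : _ - _ - _ = 0) ?expr0n//; ring.
have mfg : measurable_fun setT (fun w => X w * (W f w * W g w)).
  by apply: measurable_funM => //; exact: measurable_funM.
have ifg : P.-integrable setT (fun w => (X w * (W f w * W g w))%:E).
  have idom : P.-integrable setT (fun w => `|(X w * W f w ^+ 2)%:E| + `|(X w * W g w ^+ 2)%:E|)%E.
    by apply: integrableD => //; exact: integrable_abse.
  apply: le_integrable idom => //; first exact/measurable_EFinP.
  move=> w _ /=; rewrite lee_fin [leRHS]ger0_norm ?addr_ge0//.
  rewrite !(normrM (X w)) -mulrDr ler_wpM2l// (normrM (W f w)) !normrX.
  have := sqr_ge0 (`|W f w| - `|W g w|).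
  by have := normr_ge0 (W f w); have := normr_ge0 (W g w); nra.
split=> //.
have E : (\int[P]_w (X w * W h w ^+ 2)%:E =
   \int[P]_w (X w * W f w ^+ 2)%:E + 2%:E * \int[P]_w (X w * (W f w * W g w))%:E +
   \int[P]_w (X w * W g w ^+ 2)%:E)%E.
  rewrite -integralZl// -integralD//; last exact: integrableZl.
  rewrite -integralD//; last by apply: integrableD => //; exact: integrableZl.
  apply: ae_eq_integral => //.
  - exact: measurable_int ihh.
  - apply: emeasurable_funD; last exact: measurable_int igg.
    apply: emeasurable_funD; first exact: measurable_int iff.
    by apply: emeasurable_funM => //; exact/measurable_EFinP.
  - by apply: filterS Whfg => w /= -> _; rewrite -EFinM -!EFinD; congr EFin; ring.
have Eip : (ip h h = ip f f + 2%:E * ip f g + ip g g)%E.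
  have ifgd := square_integrableM mhalf Lf Lg.
  have iffd := square_integrableM mhalf Lf Lf.
  have iggd := square_integrableM mhalf Lg Lg.
  rewrite /halfspace_dot -integralZl// -integralD//; last exact: integrableZl.
  rewrite -integralD//; last by apply: integrableD => //; exact: integrableZl.
  by apply: eq_integral => z _; rewrite -EFinM -!EFinD /h; congr EFin; ring.
move: E; rewrite If Ig Ih Eip.
have fin a b : L2 a -> L2 b -> ip a b \is a fin_num.
  by move=> La Lb; apply: integrable_fin_num => //; exact: square_integrableM.
have fX : (\int[P]_w (X w)%:E)%E \is a fin_num by exact: integrable_fin_num.
have fI := integrable_fin_num measurableT ifg.
move: (fin f f Lf Lf) (fin g g Lg Lg) (fin f g Lf Lg) fX fI.
move: (ip f f) (ip g g) (ip f g) (\int[P]_w (X w)%:E)%E (\int[P]_w (X w * _)%:E)%E.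
move=> [a| |] [b| |] [c| |] [x| |] [y| |] //= _ _ _ _ _ /(congr1 fine) /= H.
by rewrite -EFinM; congr EFin; nra.
Qed.

End white_noise_isometry.

(** * The isometry for simple fields *)

Section walsh_isometry.
Context {R : realType} {disp : measure_display} {Omega : measurableType disp}.
Variables (P : probability Omega R) (d : nat) (F : R -> set (set Omega)).
Variable W : (measurableTypeR R * Rd R d -> R) -> Omega -> R.
Hypotheses (FF : filtration P F) (wn : white_noise P F W).
Local Notation half := (@halfspace R d).
Local Notation L2 := (@L2_halfspace R d).
Local Notation ip := (@halfspace_dot R d).
Implicit Types f g h : measurableTypeR R * Rd R d -> R.

Let mhalf : measurable half. Proof. exact: measurable_halfspace. Qed.

Definition time_cut (B : set R) f : measurableTypeR R * Rd R d -> R :=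
  fun z => \1_B (z.1 : R) * f z.

Lemma L2_time_cut (B : set R) f : measurable B -> L2 f -> L2 (time_cut B f).
Proof.
move=> mB Lf; have [mf _] := Lf.
have mi : measurable_fun setT (\1_B : measurableTypeR R -> R) by exact: measurable_indic.
apply: (@square_integrable_le _ _ _ (dtdx d) half mhalf _ (fun z => f z ^+ 2)).
- apply: measurable_funM => //.
  by apply: measurable_funTS; exact: (measurableT_comp mi measurable_fst).
- exact: square_integrable_integrable.
- move=> z _; rewrite /time_cut exprMn indicE.
  by case: (_ \in _) => /=; rewrite ?expr1n ?mul1r// expr0n mul0r sqr_ge0.
Qed.

Let before (c : R) f := time_cut `]-oo, c] f.
Let after (c : R) f := time_cut `]c, +oo[ f.

Let L2_before c f : L2 f -> L2 (before c f).
Proof. by apply: L2_time_cut; exact: measurable_itv. Qed.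

Let L2_after c f : L2 f -> L2 (after c f).
Proof. by apply: L2_time_cut; exact: measurable_itv. Qed.

Let before_after (c : R) f z : f z = before c f z + after c f z.
Proof.
rewrite /before /after /time_cut !indicE; have [h|h] := leP (z.1 : R) c.
  by rewrite mem_set ?memNset/= ?in_itv/= ?h ?mul1r ?mul0r ?addr0// ltNge h.
by rewrite memNset ?mem_set/= ?in_itv/= ?andbT ?h ?mul1r ?mul0r ?add0r// leNgt h.
Qed.

Let vanish_after c f : vanish_until c (after c f).
Proof.
move=> z _ zc; rewrite /after /time_cut indicE memNset ?mul0r//=.
by rewrite in_itv/= andbT; apply/negP; rewrite -leNgt.
Qed.

Let noise_split c f : L2 f ->
  {ae P, forall w, W f w = W (before c f) w + W (after c f) w}.
Proof.
move=> Lf; apply: (noiseD wn) => //; [exact: L2_before|exact: L2_after|].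
rewrite -[RHS](@integral0 _ _ _ (dtdx d) half); apply: eq_integral => z _.
rewrite (_ : _ - _ - _ = 0) ?expr0n//.
by have := before_after c f z; lra.
Qed.

Let adapted_before c f : 0 <= c -> L2 f -> measurable_wrt (F c) (W (before c f)).
Proof.
move=> c0 Lf; have [_ _ h _] := wn; apply: h => //; first exact: L2_before.
move=> z cz; rewrite /before /time_cut indicE memNset ?mul0r//=.
by rewrite in_itv/=; apply/negP; rewrite -ltNge.
Qed.

Lemma square_integrable_adapted_noise a X f : 0 <= a -> L2 f ->
  vanish_until a f -> measurable_wrt (F a) X -> square_integrable P setT X ->
  square_integrable P setT (fun w => X w * W f w).
Proof.
move=> a0 Lf f0 mX sX; have [mX' _] := sX.
apply: (@square_integrable_le _ _ _ P setT measurableT _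
  (fun w => (X w * X w) * (W f w * W f w))).
- by apply: measurable_funM => //; exact: (measurable_noise wn).
- apply: (integral_adapted_noise2 FF wn a0 Lf Lf f0 f0 _ _).1.
    by apply: measurable_wrtM => //; exact: (filtration_sigma_algebra FF a0).
  exact: square_integrableM.
- by move=> w _; rewrite expr2 mulrACA.
Qed.

(** The kernel f is split at the later time a'. Its part before a' contributes
    nothing, since X W(f1) X' is known at time a' while W(f') is centered and
    independent of that past; its part after a' is treated by polarization. *)
Let isometry_strict a a' X X' f f' : 0 <= a -> a <= a' ->
  measurable_wrt (F a) X -> measurable_wrt (F a') X' ->
  square_integrable P setT X -> square_integrable P setT X' ->
  L2 f -> L2 f' -> vanish_until a f -> vanish_until a' f' ->
  (\int[P]_w ((X w * W f w) * (X' w * W f' w))%:E =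
   (\int[P]_w (X w * X' w)%:E) * ip f f')%E.
Proof.
move=> a0 aa' mX mX' sX sX' Lf Lf' f0 f'0.
have a'0 : 0 <= a' by exact: le_trans a0 aa'.
have sG := filtration_sigma_algebra FF a'0.
pose f1 := before a' f; pose f2 := after a' f.
have Lf1 : L2 f1 by exact: L2_before.
have Lf2 : L2 f2 by exact: L2_after.
have f10 : vanish_until a f1.
  by move=> z z0 za; rewrite /f1 /before /time_cut f0// mulr0.
have mXa' := measurable_wrt_le FF a0 aa' mX.
have mW g : L2 g -> measurable_fun setT (W g) by move=> Lg; exact: (measurable_noise wn).
have [mXT _] := sX; have [mX'T _] := sX'.
have sXW1 := square_integrable_adapted_noise a0 Lf1 f10 mX sX.
have i1 := square_integrableM measurableT sXW1 sX'.
have m1 : measurable_wrt (F a') (fun w => X w * W f1 w * X' w).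
  apply: measurable_wrtM => //; apply: measurable_wrtM => //.
  exact: adapted_before.
have [I1 E1] := integral_adapted_noise wn a'0 Lf' f'0 m1 i1.
have i2 := square_integrableM measurableT sX sX'.
have m2 : measurable_wrt (F a') (fun w => X w * X' w) by exact: measurable_wrtM.
have [I2 E2] := integral_adapted_noise2 FF wn a'0 Lf2 Lf' (@vanish_after a' f) f'0 m2 i2.
transitivity (\int[P]_w ((X w * W f1 w * X' w * W f' w)%:E +
                         (X w * X' w * (W f2 w * W f' w))%:E))%E.
  apply: ae_eq_integral => //.
  - apply/measurable_EFinP; apply: measurable_funM;
      by apply: measurable_funM => //; exact: mW.
  - by apply: emeasurable_funD; [exact: measurable_int I1|exact: measurable_int I2].
  - by apply: filterS (noise_split a' Lf) => w -> _; rewrite -EFinD; congr EFin; ring.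
rewrite integralD// E1 add0e E2; congr (_ * _)%E.
apply: eq_integral => z; rewrite inE => -[/= z0 _].
rewrite [in RHS](before_after a' f) -/f1 -/f2.
have [za'|a'z] := leP (z.1 : R) a'.
  by rewrite f'0 ?mulr0//; move: z0; rewrite in_itv/= andbT.
by rewrite /f1 /before /time_cut indicE memNset ?mul0r ?add0r//= in_itv/= leNgt a'z.
Qed.

Section elementary_fields.
Implicit Types e : @elementary R disp Omega d.

Definition elementary_kernel e : measurableTypeR R * Rd R d -> R :=
  fun z => \1_(`[el_start e, el_end e]%classic : set R) z.1 * el_space e z.2.
Local Notation ek := elementary_kernel.

Lemma L2_elementary_kernel e : is_elementary P F e -> L2 (ek e).
Proof.
move=> [_ _ _ sphi]; have [mphi _] := sphi.
have mi : measurable_fun setT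
    (\1_(`[el_start e, el_end e]%classic : set R) : measurableTypeR R -> R).
  by apply: measurable_indic; exact: measurable_itv.
split.
  apply: measurable_funTS; apply: measurable_funM.
    exact: (measurableT_comp mi measurable_fst).
  exact: (measurableT_comp mphi measurable_snd).
have mpos : measurable (`]0, +oo[%classic : set (measurableTypeR R)) by exact: measurable_itv.
have ii : (@lebesgue_measure R).-integrable (`]0, +oo[%classic : set (measurableTypeR R))
    (EFin \o (\1_(`[el_start e, el_end e]%classic : set R))).
  apply: (integrableS measurableT mpos (@subsetT _ _)).
  exact: integrable_indic_itv.
have i2 := square_integrable_integrable sphi.
have [i3 _] := integral_tensor mpos ii i2.
apply: le_lt_trans (integrable_lty mhalf i3).
rewrite le_eqVlt; apply/orP; left; apply/eqP.
apply: eq_integral => z _; rewrite /ek exprMn; congr EFin; congr (_ * _).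
by rewrite indicE; case: (_ \in _); rewrite /= ?expr1n// expr0n.
Qed.

Let time_slice_null (a : R) : dtdx d [set z | (z.1 : R) = a] = 0%E.
Proof.
have -> : [set z : measurableTypeR R * Rd R d | (z.1 : R) = a] = [set a] `*` setT.
  by apply/seteqP; split => z /=; tauto.
rewrite /dtdx product_measure1E//= ?lebesgue_measure_set1 ?mul0e//.
Qed.

(** The interval [a, b] contains its left end, so [ek e] does not vanish at time
    a, as independence of F_a requires; removing that time slice changes the
    noise on a null event only. *)
Let ek_strict e := after (el_start e) (ek e).

Let noise_ek e : is_elementary P F e ->
  {ae P, forall w, W (ek e) w = W (ek_strict e) w}.
Proof.
move=> he; have L := L2_elementary_kernel he.
have Ls : L2 (ek_strict e) by exact: L2_after.
apply: (noise_ae_eq wn) => //.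
have [md _] := square_integrableB mhalf L Ls.
rewrite -[RHS](@integral0 _ _ _ (dtdx d) half); apply: ae_eq_integral => //.
  by apply/measurable_EFinP; exact: measurable_funX.
exists [set z | (z.1 : R) = el_start e]; split.
- rewrite -[X in measurable X]setTI.
  have := @measurable_fst _ _ (measurableTypeR R) (Rd R d) measurableT
    [set el_start e] (measurable_set1 _).
  by congr measurable.
- exact: time_slice_null.
- move=> z /=; apply: contra_notP => ze _; rewrite /cst.
  rewrite [X in (X - _) ^+ 2](before_after (el_start e)) addrK.
  rewrite /before /time_cut /ek.
  have [h|h] := boolP ((z.1 : R) <= el_start e).
    rewrite (_ : \1_(`[el_start e, _]%classic) _ = 0) ?mul0r ?mulr0 ?expr0n//.
    rewrite indicE memNset//= in_itv/=; apply/negP; rewrite negb_and -ltNge.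
    by rewrite lt_neqAle h andbT; apply/orP; left; apply/eqP.
  rewrite (_ : \1_(`]-oo, el_start e]%classic) _ = 0) ?mul0r ?expr0n//.
  by rewrite indicE memNset//= in_itv/=; exact/negP.
Qed.

Let ip_ek e e' : is_elementary P F e -> is_elementary P F e' ->
  ip (ek e) (ek e') = ip (ek_strict e) (ek_strict e').
Proof.
move=> he he'.
have L := L2_elementary_kernel he; have L' := L2_elementary_kernel he'.
have Ls : L2 (ek_strict e) by exact: L2_after.
have Ls' : L2 (ek_strict e') by exact: L2_after.
rewrite /halfspace_dot -!(noise_covariance wn)//; apply: ae_eq_integral => //.
- by apply/measurable_EFinP; apply: measurable_funM; exact: (measurable_noise wn).
- by apply/measurable_EFinP; apply: measurable_funM; exact: (measurable_noise wn).
- by apply: filterS2 (noise_ek he) (noise_ek he') => w -> -> _.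
Qed.

Let elementary_facts e : is_elementary P F e ->
  [/\ square_integrable P setT (fun w => el_coef e w * W (ek e) w),
      (\int[P]_w (el_coef e w * W (ek e) w)%:E = 0)%E,
      {ae P, forall w, el_coef e w * W (ek e) w = el_coef e w * W (ek_strict e) w} &
      measurable_fun setT (fun w => el_coef e w * W (ek_strict e) w)].
Proof.
move=> he; have L := L2_elementary_kernel he.
have Ls : L2 (ek_strict e) by exact: L2_after.
have [/andP[a0 _] mX sX _] := he; have [mXT _] := sX.
have aeW : {ae P, forall w, el_coef e w * W (ek e) w = el_coef e w * W (ek_strict e) w}.
  by apply: filterS (noise_ek he) => w ->.
have mWs : measurable_fun setT (fun w => el_coef e w * W (ek_strict e) w).
  by apply: measurable_funM => //; exact: (measurable_noise wn).
have mW : measurable_fun setT (fun w => el_coef e w * W (ek e) w).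
  by apply: measurable_funM => //; exact: (measurable_noise wn).
have van := @vanish_after (el_start e) (ek e).
split => //.
- have [_ s2] := square_integrable_adapted_noise a0 Ls van mX sX.
  split=> //; rewrite (ae_eq_integral (fun w => ((el_coef e w * W (ek_strict e) w) ^+ 2)%:E)) //.
  + by apply/measurable_EFinP; exact: measurable_funX.
  + by apply/measurable_EFinP; exact: measurable_funX.
  + by apply: filterS aeW => w -> _.
- have iX := square_integrable_prob sX.
  have [_ <-] := integral_adapted_noise wn a0 Ls van mX iX.
  apply: ae_eq_integral => //; [exact/measurable_EFinP|exact/measurable_EFinP|].
  by apply: filterS aeW => w -> _.
Qed.

Let elementary_isometry e e' : is_elementary P F e -> is_elementary P F e' ->
  (\int[P]_w ((el_coef e w * W (ek e) w) * (el_coef e' w * W (ek e') w))%:E =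
   (\int[P]_w (el_coef e w * el_coef e' w)%:E) * ip (ek e) (ek e'))%E.
Proof.
wlog aa' : e e' / el_start e <= el_start e'.
  move=> H he he'; have [aa'|a'a] := leP (el_start e) (el_start e'); first exact: H.
  have := H _ _ (ltW a'a) he' he.
  rewrite /halfspace_dot.
  under eq_integral do rewrite mulrC.
  move=> ->; congr (_ * _)%E; apply: eq_integral => ? _; by rewrite mulrC.
move=> he he'.
have [_ _ aeW mWs] := elementary_facts he; have [_ _ aeW' mWs'] := elementary_facts he'.
have [[mW _] _ _ _] := elementary_facts he; have [[mW' _] _ _ _] := elementary_facts he'.
have [/andP[a0 _] mX sX _] := he; have [/andP[a'0 _] mX' sX' _] := he'.
rewrite ip_ek// -(isometry_strict a0 aa' mX mX' sX sX')//; last 4 first.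
- exact/L2_after/L2_elementary_kernel.
- exact/L2_after/L2_elementary_kernel.
- exact: vanish_after.
- exact: vanish_after.
apply: ae_eq_integral => //.
- by apply/measurable_EFinP; exact: measurable_funM.
- by apply/measurable_EFinP; exact: measurable_funM.
- by apply: filterS2 aeW aeW' => w -> -> _.
Qed.

Lemma simple_integral_mean_isometry (S : seq (@elementary R disp Omega d)) :
  is_simple P F S ->
  [/\ square_integrable P setT (simple_integral W S),
      (\int[P]_w (simple_integral W S w)%:E = 0)%E,
      square_integrable (dtdx d \x P)%E (half `*` setT)
        (fun z => simple_field S z.1.1 z.1.2 z.2) &
      (\int[P]_w ((simple_integral W S w) ^+ 2)%:E =
       \int[dtdx d \x P]_(z in half `*` setT)
         ((simple_field S z.1.1 z.1.2 z.2) ^+ 2)%:E)%E].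
Proof.
move=> hS.
pose e i := tnth (in_tuple S) i.
pose Y (i : 'I_(size S)) w := el_coef (e i) w * W (ek (e i)) w.
pose Z (i : 'I_(size S)) (z : measurableTypeR R * Rd R d * Omega) :=
  ek (e i) z.1 * el_coef (e i) z.2.
have YE : simple_integral W S = fun w => \sum_i Y i w.
  by apply/funext => w; rewrite /simple_integral big_tnth.
have ZE (z : measurableTypeR R * Rd R d * Omega) :
    simple_field S z.1.1 z.1.2 z.2 = \sum_i Z i z.
  rewrite /simple_field big_tnth; apply: eq_bigr => i _.
  by rewrite /Z /ek -/(e i); ring.
have sY i : square_integrable P setT (Y i) by have [] := elementary_facts (hS i).
have mhT : measurable (half `*` [set: Omega]) by exact: measurableX.
have iekM i j := square_integrableM mhalf
  (L2_elementary_kernel (hS i)) (L2_elementary_kernel (hS j)).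
have iXM i j : P.-integrable setT (fun w => (el_coef (e i) w * el_coef (e j) w)%:E).
  by have [_ _ si _] := hS i; have [_ _ sj _] := hS j; exact: square_integrableM.
have tens i j := integral_tensor mhalf (iekM i j) (iXM i j).
have ZZ i j z : Z i z * Z j z =
    (ek (e i) z.1 * ek (e j) z.1) * (el_coef (e i) z.2 * el_coef (e j) z.2).
  by rewrite /Z mulrACA.
have sZ i : square_integrable (dtdx d \x P)%E (half `*` setT) (Z i).
  split; last first.
    apply: le_lt_trans (integrable_lty mhT (tens i i).1).
    rewrite le_eqVlt; apply/orP; left; apply/eqP.
    by apply: eq_integral => z _; rewrite expr2 ZZ.
  have [mek _] := L2_elementary_kernel (hS i); have [_ _ [mX _] _] := hS i.
  apply: measurable_funM; last first.
    by apply: measurable_funTS; exact: (measurableT_comp mX measurable_snd).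
  apply: (measurable_comp mhalf _ mek); first by move=> _ [z [? _] <-].
  exact: measurable_funTS measurable_fst.
rewrite YE; split.
- exact: square_integrable_sum.
- under eq_integral do rewrite -sumEFin.
  rewrite integral_sum//; last by move=> i; exact: square_integrable_prob.
  by rewrite big1// => i _; have [] := elementary_facts (hS i).
- by under eq_fun do rewrite ZE; exact: square_integrable_sum.
- under [RHS]eq_integral do rewrite ZE.
  rewrite integral_sqr_sum// integral_sqr_sum//.
  apply: eq_bigr => i _; apply: eq_bigr => j _.
  under [RHS]eq_integral do rewrite ZZ.
  rewrite (tens i j).2 [RHS]muleC; exact: elementary_isometry.
Qed.

End elementary_fields.

End walsh_isometry.

(** * Second moment of a Walsh integral *)

Section walsh_energy.
Context {R : realType}.

Lemma cvge0_lt (u : nat -> \bar R) (e : R) : 0 < e -> u n @[n --> \oo] --> (0%E : \bar R) ->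
  \forall n \near \oo, (u n < e%:E)%E.
Proof.
move=> e0 u0; apply: (u0 [set x : \bar R | (x < e%:E)%E]).
apply: open_nbhs_nbhs; split; first exact: open_ereal_lt_ereal.
by rewrite /= lte_fin.
Qed.

Lemma ge0_lty_EFin (x : \bar R) : (0 <= x)%E -> (x < +oo)%E ->
  exists2 r : R, 0 <= r & x = r%:E.
Proof. by case: x => // r; exists r. Qed.

Lemma integral_sqr_le_sub {d} {T : measurableType d} (mu : {measure set T -> \bar R})
    (D : set T) (f g : T -> R) : measurable D ->
  measurable_fun D f -> measurable_fun D g ->
  (\int[mu]_(x in D) ((f x) ^+ 2)%:E <=
   2%:E * \int[mu]_(x in D) ((g x) ^+ 2)%:E + 2%:E * \int[mu]_(x in D) ((f x - g x) ^+ 2)%:E)%E.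
Proof.
move=> mD mf mg.
have mfg : measurable_fun D (fun x => f x - g x) by exact: measurable_funB.
have msq (h : T -> R) : measurable_fun D h -> measurable_fun D (fun x => (h x ^+ 2)%:E).
  by move=> mh; apply/measurable_EFinP; exact: measurable_funX.
have sq0 (h : T -> R) x : (0 <= ((h x) ^+ 2)%:E)%E by rewrite lee_fin sqr_ge0.
rewrite -ge0_integralZl_EFin; [|by []|by move=> x _; exact: sq0|exact: msq|by []].
rewrite -ge0_integralZl_EFin; [|by []
  |by move=> x _; exact: (sq0 (fun x => f x - g x))|exact: msq|by []].
have m2 (h : T -> R) : measurable_fun D h -> measurable_fun D (fun x => 2%:E * (h x ^+ 2)%:E)%E.
  by move=> mh; apply: emeasurable_funM => //; exact: msq.
have p2 (h : T -> R) x : (0 <= 2%:E * ((h x) ^+ 2)%:E)%E by rewrite mule_ge0// sq0.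
rewrite -ge0_integralD; [|by []|by move=> x _; exact: p2|exact: m2
  |by move=> x _; exact: (p2 (fun x => f x - g x))|exact: m2].
apply: ge0_le_integral; first by [].
- by move=> x _; exact: sq0.
- exact: msq.
- by apply: emeasurable_funD; exact: m2.
- move=> x _; rewrite -!EFinM -EFinD lee_fin.
  by have := sqr_ge0 (2 * g x - f x); nra.
Qed.

Context {disp : measure_display} {Omega : measurableType disp}.
Variables (P : probability Omega R) (d : nat) (F : R -> set (set Omega)).
Variable W : (measurableTypeR R * Rd R d -> R) -> Omega -> R.
Hypotheses (FF : filtration P F) (wn : white_noise P F W).
Local Notation half := (@halfspace R d).

(** One approximating simple field suffices: if both approximation errors are
    below A^2/8, then (x + y)^2 <= 2 x^2 + 2 y^2 transfers the exact identity
    E (A + Y)^2 = A^2 + |Z|^2, for the simple field Z with integral Y, to I and Psi.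
    The loss of the factor 1/4 is harmless for the blow-up argument. *)
Lemma walsh_energy (Phi : R -> Rd R d -> Omega -> R) (I : Omega -> R) (A : R) :
  0 < A -> walsh_integral P F W Phi I ->
  square_integrable P setT I /\
  exists Psi : measurableTypeR R * Rd R d * Omega -> R,
    [/\ measurable_fun (half `*` setT) Psi,
        {ae (dtdx d \x P)%E, forall z, 0 < (z.1.1 : R) -> Psi z = Phi z.1.1 z.1.2 z.2} &
        ((A ^+ 2 / 4)%:E +
          (1 / 4)%:E * \int[(dtdx d \x P)%E]_(z in half `*` setT) ((Psi z) ^+ 2)%:E
         <= \int[P]_w ((A + I w) ^+ 2)%:E)%E].
Proof.
move=> A0 [mI [Psi [S [mPsi PsiE hS cvS cvI]]]].
have mD : measurable (half `*` [set: Omega]).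
  by apply: measurableX => //; exact: measurable_halfspace.
have A80 : 0 < A ^+ 2 / 8 by rewrite divr_gt0// exprn_gt0.
have [n [eS eI]] : exists n,
    (\int[(dtdx d \x P)%E]_(z in half `*` setT)
       ((simple_field (S n) z.1.1 z.1.2 z.2 - Psi z) ^+ 2)%:E < (A ^+ 2 / 8)%:E)%E /\
    (\int[P]_w ((simple_integral W (S n) w - I w) ^+ 2)%:E < (A ^+ 2 / 8)%:E)%E.
  have cI := cvge0_lt A80 cvI; have cS := cvge0_lt A80 cvS.
  have [n _ h] := filterI cI cS; exists n.
  by have [] := h n (leqnn _); rewrite unlock.
have [sY EY sZ YZ] := simple_integral_mean_isometry FF wn (hS n).
set Y := simple_integral W (S n) in sY EY YZ eI.
pose Z (z : measurableTypeR R * Rd R d * Omega) := simple_field (S n) z.1.1 z.1.2 z.2.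
rewrite -/(Z _) in sZ YZ eS.
have [mY fY] := sY; have [mZ fZ] := sZ.
have sYI : square_integrable P setT (fun w => Y w - I w).
  by split; [exact: measurable_funB|exact: lt_trans eI (ltry _)].
have sI : square_integrable P setT I.
  rewrite (_ : I = fun w => Y w - (Y w - I w)); first exact: square_integrableB.
  by apply/funext => w; rewrite opprB addrC subrK.
split=> //; exists Psi; split=> //.
have sA : square_integrable P setT (fun=> A).
  by split=> //; rewrite integral_cst//= probability_setT mule1 ltry.
have sAI : square_integrable P setT (fun w => A + I w) by exact: square_integrableD.
have sAY : square_integrable P setT (fun w => A + Y w) by exact: square_integrableD.
have E1 : (\int[P]_w ((A + Y w) ^+ 2)%:E = (A ^+ 2)%:E + \int[P]_w ((Y w) ^+ 2)%:E)%E.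
  have iY := square_integrable_prob sY.
  have iY2 := square_integrable_integrable sY.
  have iA : P.-integrable setT (fun=> (A ^+ 2)%:E) by exact: finite_measure_integrable_cst.
  transitivity (\int[P]_w ((A ^+ 2)%:E + ((2 * A)%:E * (Y w)%:E + (Y w ^+ 2)%:E)))%E.
    by apply: eq_integral => w _; rewrite -EFinM -!EFinD; congr EFin; ring.
  rewrite integralD//; last by apply: integrableD => //; exact: integrableZl.
  rewrite integralD//; last exact: integrableZl.
  rewrite integralZl// EY mule0 add0e integral_cst//= probability_setT mule1//.
have [mAI fAI] := sAI; have [mAY fAY] := sAY; have [mYI fYI] := sYI.
have := integral_sqr_le_sub P measurableT mAY mAI.
have -> : (\int[P]_w ((A + Y w - (A + I w)) ^+ 2)%:E = \int[P]_w ((Y w - I w) ^+ 2)%:E)%E.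
  by apply: eq_integral => w _; congr EFin; ring.
rewrite E1 YZ => E2.
have := integral_sqr_le_sub (dtdx d \x P)%E mD mPsi mZ.
have -> : (\int[(dtdx d \x P)%E]_(z in half `*` setT) ((Psi z - Z z) ^+ 2)%:E =
    \int[(dtdx d \x P)%E]_(z in half `*` setT) ((Z z - Psi z) ^+ 2)%:E)%E.
  by apply: eq_integral => w _; congr EFin; ring.
move=> E3.
have sq0 d' (T : measurableType d') (m : {measure set T -> \bar R}) (D : set T)
  (h : T -> R) : (0 <= \int[m]_(x in D) ((h x) ^+ 2)%:E)%E.
  by apply: integral_ge0 => x _; rewrite lee_fin sqr_ge0.
have [x1 _ X1] := ge0_lty_EFin (sq0 _ _ P setT (fun w => A + I w)) fAI.
have [x2 _ X2] := ge0_lty_EFin (sq0 _ _ P setT (fun w => Y w - I w)) fYI.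
have [x3 _ X3] := ge0_lty_EFin (sq0 _ _ (dtdx d \x P)%E (half `*` setT) Z) fZ.
have [x4 _ X4] := ge0_lty_EFin
  (sq0 _ _ (dtdx d \x P)%E (half `*` setT) (fun z => Z z - Psi z)) (lt_trans eS (ltry _)).
move: E2 E3 eS eI; rewrite /= in X1 X2 X3 X4; rewrite X1 X2 X3 X4.
rewrite -!EFinM -!EFinD !lte_fin lee_fin => E2 E3 eS eI.
have [x5 _ X5] := ge0_lty_EFin
  (sq0 _ _ (dtdx d \x P)%E (half `*` setT) Psi) (le_lt_trans E3 (ltry _)).
rewrite /= in X5; move: E3; rewrite X5 lee_fin -EFinM -EFinD lee_fin => E3.
lra.
Qed.

End walsh_energy.

(** * Blow-up of the second moment *)

Lemma ae_product d1 d2 (T1 : measurableType d1) (T2 : measurableType d2)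
    (R : realType) (m1 : {sigma_finite_measure set T1 -> \bar R})
    (m2 : {sigma_finite_measure set T2 -> \bar R}) (Q : T1 * T2 -> Prop) :
  {ae (m1 \x m2)%E, forall z, Q z} ->
  {ae m1, forall x, {ae m2, forall y, Q (x, y)}}.
Proof.
move=> [N [mN N0 QN]].
have mf : measurable_fun setT (m2 \o xsection N) by exact: measurable_fun_xsection.
have /(ae_eq_integral_abs m1 measurableT mf) : (\int[m1]_x `|(m2 \o xsection N) x| = 0)%E.
  by rewrite -[RHS]N0; apply: eq_integral => x _; rewrite gee0_abs.
apply: filterS => x /= /(_ I) Nx0.
exists (xsection N x); split=> //; first exact: measurable_xsection.
by move=> y Qy; rewrite /xsection/= inE; exact: QN.
Qed.

Section blow_up.
Context {R : realType}.
Variables (nu beta alpha : R) (d : nat) (p : R -> Rd R d -> R) (g : R -> R).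
Context {disp : measure_display} {Omega : measurableType disp}.
Variables (P : probability Omega R) (F : R -> set (set Omega)).
Variable W : (measurableTypeR R * Rd R d -> R) -> Omega -> R.
Variables (u0 : Rd R d -> R) (sigma : R -> R) (eps : R).
Hypotheses (nu0 : 0 < nu) (beta0 : 0 < beta) (alpha0 : 0 < alpha) (d0 : (0 < d)%N).
Hypothesis dab : beta * d%:R / alpha < 1.
Hypotheses (sp : stable_density nu alpha p) (sg : subordinator_density beta g).
Hypotheses (FF : filtration P F) (wn : white_noise P F W).
Hypothesis mu0 : measurable_fun setT u0.
Hypothesis u0_bounded : exists M, forall x, `|u0 x| <= M.
Variables (kappa c : R).
Hypotheses (kappa0 : 0 < kappa) (c0 : 0 < c) (eps0 : 0 < eps).
Hypothesis u0_ge : forall x, kappa <= u0 x.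
Hypothesis sigma_ge : forall y, y != 0 -> c * `|y| `^ (1 + eps) <= `|sigma y|.
Variable u : R -> Rd R d -> Omega -> R.
Local Notation G := (heat_kernel beta p g).
Hypothesis mild : mild_solution P F W G sigma u0 u.
Local Notation half := (@halfspace R d).
Local Notation lam := (@lebesgue_measure R).

Let second_moment (t : R) (x : Rd R d) := (\int[P]_w ((u t x w) ^+ 2)%:E)%E.

(** A form of the superlinear growth of sigma that is affine in y^2: taking
    expectations then needs no convexity inequality. It is trivial if y^2 < a, and
    otherwise (y^2)^(1 + eps) >= a^eps y^2. *)
Let sigma_sqr_ge (a y : R) : 0 < a ->
  c ^+ 2 * a `^ eps * (y ^+ 2 - a) <= sigma y ^+ 2.
Proof.
move=> a0; have [ya|ya] := ltP (y ^+ 2) a.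
  apply: (@le_trans _ _ 0); last exact: sqr_ge0.
  apply: mulr_ge0_le0; last by rewrite subr_le0 ltW.
  by rewrite mulr_ge0 ?sqr_ge0 ?powR_ge0.
have y20 : 0 < y ^+ 2 by exact: lt_le_trans ya.
have y0 : y != 0 by apply: contraTneq y20 => ->; rewrite expr0n ltxx.
apply: (@le_trans _ _ (c ^+ 2 * (y ^+ 2 * (y ^+ 2) `^ eps))).
  rewrite -mulrA; apply: ler_wpM2l; first exact: sqr_ge0.
  rewrite mulrC; apply: ler_pM => //; rewrite ?powR_ge0 ?subr_ge0//.
    by rewrite gerBl ltW.
  by rewrite ge0_ler_powR// ?nnegrE ltW.
have -> : y ^+ 2 * (y ^+ 2) `^ eps = (`|y| `^ (1 + eps)) ^+ 2.
  rewrite -[X in X * _](@powRr1 _ (y ^+ 2)) ?sqr_ge0// -powRD; last first.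
    by apply/implyP => _; rewrite gt_eqF.
  by rewrite -(real_normK (num_real y)) expr2 powRM// expr2.
rewrite -exprMn -(real_normK (num_real (sigma y))).
rewrite lerXn2r// ?nnegrE// ?sigma_ge//.
by rewrite mulr_ge0 ?powR_ge0// ltW.
Qed.

Let measurable_u (t : R) (x : Rd R d) : 0 <= t -> measurable_fun setT (u t x).
Proof.
move=> t0; have [h _ _] := mild.
have := measurable_wrt_filtration FF t0 (h t x t0).
by [].
Qed.

Let measurable_G_subv (t : R) (x : Rd R d) : 0 < t -> measurable_fun setT (fun y => G t (subv x y)).
Proof.
move=> t0; apply: measurableT_comp; last exact: measurable_subv.
exact: (measurable_heat_kernel beta0 sp sg t0).
Qed.

Let drift (t : R) (x : Rd R d) : R := \int[lebesgue_Rd d]_y (u0 y * G t (subv x y)).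

Let drift_ge (t : R) (x : Rd R d) : 0 < t -> kappa <= drift t x.
Proof.
move=> t0; have [M uM] := u0_bounded.
have G0 y : 0 <= G t (subv x y) by exact: (heat_kernel_ge0 beta0 sp sg).
have IG : (\int[lebesgue_Rd d]_y (G t (subv x y))%:E = 1)%E.
  rewrite (@ge0_integral_subv _ _ x (fun y => (G t y)%:E)).
  - exact: (integral_heat_kernel alpha0 beta0 sp sg).
  - by apply/measurable_EFinP; exact: (measurable_heat_kernel beta0 sp sg t0).
  - by move=> y; rewrite lee_fin; exact: (heat_kernel_ge0 beta0 sp sg).
have iG : (lebesgue_Rd d).-integrable setT (fun y => (G t (subv x y))%:E).
  apply/integrableP; split; first by apply/measurable_EFinP; exact: measurable_G_subv.
  under eq_integral do rewrite gee0_abs ?lee_fin//.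
  by rewrite IG ltry.
have iuG : (lebesgue_Rd d).-integrable setT (fun y => (u0 y * G t (subv x y))%:E).
  have iM : (lebesgue_Rd d).-integrable setT (fun y => M%:E * (G t (subv x y))%:E)%E.
    exact: integrableZl.
  apply: le_integrable iM => //.
    by apply/measurable_EFinP; apply: measurable_funM => //; exact: measurable_G_subv.
  move=> y _; rewrite -EFinM /= lee_fin !normrM ler_wpM2r//.
  by apply: le_trans (uM y) _; exact: ler_norm.
rewrite /drift /Rintegral -lee_fin fineK; last exact: integrable_fin_num.
rewrite -[leLHS]mule1 -IG -integralZl//; apply: le_integral => //; first exact: integrableZl.
by move=> y _; rewrite -EFinM lee_fin ler_wpM2r.
Qed.

Let moment_decomposition (t : R) (x : Rd R d) : 0 < t ->
  (second_moment t x < +oo)%E /\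
  exists Psi : measurableTypeR R * Rd R d * Omega -> R,
    [/\ measurable_fun (half `*` setT) Psi,
        {ae (dtdx d \x P)%E, forall z, 0 < (z.1.1 : R) ->
          Psi z = \1_(`]0, t[%classic : set R) z.1.1 *
            (sigma (u z.1.1 z.1.2 z.2) * G (t - z.1.1) (subv x z.1.2))} &
        ((kappa ^+ 2 / 4)%:E +
          (1 / 4)%:E * \int[(dtdx d \x P)%E]_(z in half `*` setT) ((Psi z) ^+ 2)%:E
         <= second_moment t x)%E].
Proof.
move=> t0; have [_ _ /(_ t x t0) [I [wI uE]]] := mild.
have Ak := drift_ge x t0; have A0 : 0 < drift t x by exact: lt_le_trans Ak.
have [sI [Psi [mPsi PsiE H]]] := walsh_energy FF wn A0 wI.
have [mI _] := sI.
have sA : square_integrable P setT (fun=> drift t x).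
  by split=> //; rewrite integral_cst//= probability_setT mule1 ltry.
have [mAI fAI] : square_integrable P setT (fun w => drift t x + I w) by exact: square_integrableD.
have E : second_moment t x = (\int[P]_w ((drift t x + I w) ^+ 2)%:E)%E.
  apply: ae_eq_integral => //.
  - by apply/measurable_EFinP; apply: measurable_funX; exact: (measurable_u _ (ltW t0)).
  - by apply/measurable_EFinP; exact: measurable_funX.
  - by apply: filterS uE => w -> _.
rewrite E; split=> //; exists Psi; split=> //; apply: le_trans H.
apply: leeD2r; rewrite lee_fin ler_pM2r//.
by rewrite lerXn2r// nnegrE ltW.
Qed.

Let moment_ge (t : R) (x : Rd R d) : 0 < t -> ((kappa ^+ 2 / 4)%:E <= second_moment t x)%E.
Proof.
move=> t0; have [_ [Psi [_ _ h]]] := moment_decomposition x t0; apply: le_trans h.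
rewrite leeDl// mule_ge0// ?lee_fin//.
by apply: integral_ge0 => z _; rewrite lee_fin sqr_ge0.
Qed.

(** By [walsh_energy], a quarter of the integral of E sigma(u_r(y))^2 G_(t-r)(x-y)^2
    over y and over r in (t1, t) bounds E u_t(x)^2 from below. Applying [sigma_sqr_ge] at level a / 2,
    E sigma(u_r(y))^2 >= c^2 (a/2)^eps (a - a/2), and the kernel contributes at least
    C (t - r)^(-b) >= C T^(-b). *)
Let moment_growth (C T a t1 t : R) x : 0 < C ->
  (forall s, 0 < s ->
    ((C * s `^ (- (beta * d%:R / alpha)))%:E <= \int[lebesgue_Rd d]_y (G s y ^+ 2)%:E)%E) ->
  0 < a -> 0 <= t1 -> t1 < t -> t <= T ->
  (forall r y, t1 < r -> r <= T -> (a%:E <= second_moment r y)%E) ->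
  ((1 / 4 * (c ^+ 2 * ((a / 2) `^ eps * (a / 2)) *
    (C * T `^ (- (beta * d%:R / alpha))) * (t - t1)))%:E
    <= second_moment t x)%E.
Proof.
move=> C0 HC a0 t10 t1t tT Hm.
have t0 : 0 < t by exact: le_lt_trans t1t.
have [_ [Psi [mPsi PsiE h]]] := moment_decomposition x t0; apply: le_trans h.
set b := beta * d%:R / alpha in HC *.
have b0 : 0 < b by rewrite divr_gt0// mulr_gt0// ltr0n.
(* the level at which sigma_sqr_ge is applied; E u^2 - A >= A, half of a *)
set A := a / 2; have A0 : 0 < A by rewrite divr_gt0.
pose K := c ^+ 2 * (A `^ eps * A).
have K0 : 0 < K by rewrite mulr_gt0 ?exprn_gt0// mulr_gt0// powR_gt0.
have mD : measurable (half `*` [set: Omega]).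
  by apply: measurableX => //; exact: measurable_halfspace.
pose f : measurableTypeR R * Rd R d * Omega -> \bar R :=
  (fun z => (Psi z ^+ 2)%:E) \_ (half `*` setT).
have f0 z : (0 <= f z)%E by rewrite /f patchE; case: ifP => // _; rewrite lee_fin sqr_ge0.
have mf : measurable_fun setT f.
  apply/(measurable_restrictT _ _).1 => //.
  by apply/measurable_EFinP; exact: measurable_funX.
pose Q z := (\int[P]_w f (z, w))%E.
have Q0 z : (0 <= Q z)%E by exact: integral_ge0.
have mQ : measurable_fun setT Q by exact: (measurable_fun_fubini_tonelli_F f).
have pointwise r y : t1 < r -> r < t ->
    {ae P, forall w, 0 < r -> Psi ((r, y), w) = \1_(`]0, t[%classic : set R) r *
            (sigma (u r y w) * G (t - r) (subv x y))} ->
    ((K * G (t - r) (subv x y) ^+ 2)%:E <= Q (r, y))%E.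
  move=> t1r rt Pw; have r0 : 0 < r by exact: le_lt_trans t1r.
  set ga := G (t - r) (subv x y).
  have inD w : half ((r, y)) by split => //=; rewrite in_itv/= r0.
  have fE w : f ((r, y), w) = (Psi ((r, y), w) ^+ 2)%:E.
    by rewrite /f patchE mem_set//; split => //; exact: inD.
  have mfr : measurable_fun setT (fun w => f ((r, y), w)).
    exact: (measurable_fun_pair2 (r, y) mf).
  have mu2 : measurable_fun setT (fun w => u r y w ^+ 2).
    by apply: measurable_funX; exact: (measurable_u _ (ltW r0)).
  have cc0 : 0 <= c ^+ 2 * ga ^+ 2 * A `^ eps.
    by apply: mulr_ge0; [rewrite -exprMn sqr_ge0|exact: powR_ge0].
  have H : ((c ^+ 2 * ga ^+ 2 * A `^ eps)%:E * second_moment r y <=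
            Q (r, y) + (K * ga ^+ 2)%:E)%E.
    rewrite /second_moment -ge0_integralZl_EFin//; last 2 first.
    - by move=> w _; rewrite lee_fin sqr_ge0.
    - exact/measurable_EFinP.
    have -> : ((K * ga ^+ 2)%:E = \int[P]_w (K * ga ^+ 2)%:E)%E.
      by rewrite integral_cst//= probability_setT mule1.
    have Kg0 : 0 <= K * ga ^+ 2 by rewrite mulr_ge0 ?sqr_ge0// ltW.
    rewrite -ge0_integralD//.
    apply: ae_ge0_le_integral => //.
    - by move=> w _; rewrite -EFinM lee_fin mulr_ge0// sqr_ge0.
    - by apply: emeasurable_funM => //; exact/measurable_EFinP.
    - by move=> w _; rewrite adde_ge0// lee_fin.
    - by apply: emeasurable_funD.
    apply: filterS Pw => w /(_ r0) Pw _; rewrite fE Pw.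
    rewrite indicE mem_set/= ?in_itv/= ?r0 ?rt// mul1r -/ga -EFinM -EFinD lee_fin.
    have := sigma_sqr_ge (u r y w) A0; have := sqr_ge0 ga.
    rewrite /K exprMn; set s2 := sigma _ ^+ 2; set u2 := u r y w ^+ 2.
    move=> g20 sg2; have := ler_wpM2r g20 sg2; nra.
  have := Hm r y t1r (le_trans (ltW rt) tT).
  move: H; case: (second_moment r y) => [m| |] //=.
  - case: (Q (r, y)) (Q0 (r, y)) => [q| |] // _; last by move=> _ _; exact: leey.
    rewrite -EFinM -EFinD !lee_fin => H am.
    have : c ^+ 2 * ga ^+ 2 * A `^ eps * a <= c ^+ 2 * ga ^+ 2 * A `^ eps * m.
      exact: ler_wpM2l.
    have -> : c ^+ 2 * ga ^+ 2 * A `^ eps * a = 2 * (K * ga ^+ 2) by rewrite /K /A; field.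
    lra.
  - move=> H _; have [ga0|ga0] := eqVneq ga 0; first by rewrite ga0 expr0n mulr0.
    have cc1 : 0 < c ^+ 2 * ga ^+ 2 * A `^ eps.
      apply: mulr_gt0; last exact: powR_gt0.
      by apply: mulr_gt0; [exact: exprn_gt0|rewrite exprn_even_gt0].
    move: H; rewrite gt0_muley ?lte_fin//; case: (Q (r, y)) => [q| |] // _.
    exact: leey.
have section_ge r : t1 < r -> r < t ->
    {ae lebesgue_Rd d, forall y, {ae P, forall w, 0 < r ->
       Psi ((r, y), w) = \1_(`]0, t[%classic : set R) r *
            (sigma (u r y w) * G (t - r) (subv x y))}} ->
    ((K * (C * T `^ (- b)))%:E <= \int[lebesgue_Rd d]_y Q (r, y))%E.
  move=> t1r rt Pw; have tr0 : 0 < t - r by rewrite subr_gt0.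
  apply: (@le_trans _ _ (K%:E * \int[lebesgue_Rd d]_y (G (t - r) (subv x y) ^+ 2)%:E)%E).
    rewrite EFinM; apply: lee_wpmul2l; first by rewrite lee_fin ltW.
    rewrite (@ge0_integral_subv _ _ x (fun y => (G (t - r) y ^+ 2)%:E)); last 2 first.
    - apply/measurable_EFinP; apply: measurable_funX.
      exact: (measurable_heat_kernel beta0 sp sg tr0).
    - by move=> y; rewrite lee_fin sqr_ge0.
    apply: le_trans (HC _ tr0); rewrite lee_fin ler_pM2l// !powRN.
    have T0 : 0 < T by exact: lt_le_trans tT.
    rewrite lef_pV2 ?posrE ?powR_gt0//.
    apply: ge0_ler_powR; rewrite ?nnegrE; lra.
  have mG2 : measurable_fun setT (fun y => (G (t - r) (subv x y) ^+ 2)%:E).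
    by apply/measurable_EFinP; apply: measurable_funX; exact: measurable_G_subv.
  rewrite -ge0_integralZl_EFin//; last 2 first.
  - by move=> y _; rewrite lee_fin sqr_ge0.
  - by rewrite ltW.
  apply: ae_ge0_le_integral => //.
  - by move=> y _; rewrite -EFinM lee_fin mulr_ge0 ?sqr_ge0// ltW.
  - by apply: emeasurable_funM.
  - exact: (measurable_fun_pair2 r mQ).
  - apply: filterS Pw => y Py _; rewrite -EFinM; exact: pointwise.
have -> : (\int[(dtdx d \x P)%E]_(z in half `*` setT) (Psi z ^+ 2)%:E =
    \int[lam]_r \int[lebesgue_Rd d]_y Q (r, y))%E.
  rewrite integral_mkcond -/f (fubini_tonelli1 f)//.
  by rewrite -(fubini_tonelli1 Q).
rewrite -[leLHS]add0e; apply: leeD; first by rewrite lee_fin divr_ge0 ?sqr_ge0.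
rewrite EFinM; apply: lee_wpmul2l; first by rewrite lee_fin.
have -> : ((K * (C * T `^ (- b)) * (t - t1))%:E =
   \int[lam]_(r in `]t1, t[) (K * (C * T `^ (- b)))%:E)%E.
  by rewrite integral_cst//= lebesgue_measure_itv/= lte_fin t1t -EFinB -EFinM.
have KC0 : 0 <= K * (C * T `^ (- b)).
  apply: mulr_ge0; first exact: ltW.
  by apply: mulr_ge0; [exact: ltW|exact: powR_ge0].
rewrite integral_mkcond; apply: ae_ge0_le_integral => //.
- by move=> r _; rewrite patchE; case: ifP => // _; rewrite lee_fin.
- by apply/(measurable_restrictT _ _).1 => //; exact: measurable_itv.
- by move=> r _; exact: integral_ge0.
- exact: (measurable_fun_fubini_tonelli_F Q).
apply: filterS (ae_product (ae_product PsiE)) => r Pr _.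
rewrite patchE; case: ifPn => [|_]; last exact: integral_ge0.
by rewrite inE/= in_itv/= => /andP[t1r rt]; exact: section_ge.
Qed.

(** Lower bounds a_n = 2^n a_0 for E u_r(y)^2 hold on (s_n, T], uniformly in y: doubling
    the bound takes a time 2 / (K T^(-b) a_n^eps), which is geometric in n with ratio
    q = 2^(-eps). With s_n = T (1 - q^n) all steps fit in [0, T] provided that
    T^(1-b) = 2 / (K a_0^eps (1 - q)), and b < 1 allows this choice of T. At time T
    all the bounds hold at once. *)
Lemma no_mild_solution : False.
Proof.
have [C C0 HC] := integral_heat_kernel_sqr nu0 alpha0 beta0 d0 sp sg.
have b_lt1 := dab; set b := beta * d%:R / alpha in HC b_lt1.
pose a0 := kappa ^+ 2 / 4; have a00 : 0 < a0 by rewrite divr_gt0// exprn_gt0.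
pose q : R := (2 `^ eps)^-1.
have e2 : 1 < 2 `^ eps :> R.
  have : 1 `^ eps < 2 `^ eps :> R by apply: gt0_ltr_powR; rewrite ?nnegrE// ltr1n.
  by rewrite powR1.
have q0 : 0 < q by rewrite invr_gt0 powR_gt0.
have q1 : q < 1 by rewrite invf_lt1// powR_gt0.
pose K := 1 / 4 * (c ^+ 2 * (2^-1 `^ eps / 2) * C).
have K0 : 0 < K.
  by rewrite !mulr_gt0 ?exprn_gt0 ?powR_gt0// invr_gt0.
pose L := 2 / (K * a0 `^ eps * (1 - q)).
have L0 : 0 < L by rewrite divr_gt0// !mulr_gt0 ?powR_gt0// subr_gt0.
have b1 : 0 < 1 - b by rewrite subr_gt0.
pose T := L `^ (1 - b)^-1.
have T0 : 0 < T by rewrite powR_gt0.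
have TL : T `^ (- b) * T = L.
  have -> : T `^ (- b) * T = T `^ (1 - b).
    by rewrite mulrC addrC -[X in X * _](powRr1 (ltW T0)) -powRD ?(addrC (- b))// gt_eqF// implybT.
  by rewrite /T -powRrM mulVf ?gt_eqF// powRr1// ltW.
pose a n : R := a0 * 2 ^+ n.
have an0 n : 0 < a n by rewrite mulr_gt0// exprn_gt0.
pose s n : R := T * (1 - q ^+ n).
have s_ge0 n : 0 <= s n.
  by apply: mulr_ge0; [exact: ltW|rewrite subr_ge0 (exprn_ile1 _ (ltW q0) (ltW q1))].
have key n r y : s n < r -> r <= T -> ((a n)%:E <= second_moment r y)%E.
  elim: n r y => [|n IH] r y snr rT.
    rewrite /a expr0 mulr1; apply: moment_ge.
    by move: snr; rewrite /s expr0 subrr mulr0.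
  (* one step lasts exactly the waiting time that doubles the bound *)
  have ss : s n.+1 - s n = T * q ^+ n * (1 - q) by rewrite /s exprS; ring.
  have snr' : s n < r.
    apply: le_lt_trans snr; rewrite -subr_ge0 ss.
    apply: mulr_ge0; last by rewrite subr_ge0 ltW.
    by apply: mulr_ge0; [exact: ltW|exact: exprn_ge0 (ltW q0)].
  have := moment_growth y C0 HC (an0 n) (s_ge0 n) snr' rT IH.
  apply: le_trans; rewrite lee_fin.
  have E1 : (a n / 2) `^ eps = a0 `^ eps * q^-1 ^+ n * 2^-1 `^ eps.
    have p2n : 0 <= 2 ^+ n :> R by exact: exprn_ge0.
    have h2 : 0 <= 2^-1 :> R by rewrite invr_ge0.
    rewrite (powRM _ (ltW (an0 n)) h2) /a (powRM _ (ltW a00) p2n).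
    congr (_ * _ * _).
    by rewrite /q invrK -!powR_mulrn ?powR_ge0// -!powRrM mulrC.
  rewrite -/b E1.
  have -> : 1 / 4 * (c ^+ 2 * (a0 `^ eps * q^-1 ^+ n * 2^-1 `^ eps * (a n / 2)) *
      (C * T `^ (- b)) * (r - s n)) =
    a n * K * a0 `^ eps * q^-1 ^+ n * T `^ (- b) * (r - s n) by rewrite /K; ring.
  have -> : a n.+1 = a n * K * a0 `^ eps * q^-1 ^+ n * T `^ (- b) * (s n.+1 - s n).
    rewrite ss.
    have -> : a n * K * a0 `^ eps * q^-1 ^+ n * T `^ (- b) * (T * q ^+ n * (1 - q)) =
      a n * (K * a0 `^ eps * (1 - q)) * (T `^ (- b) * T) * (q^-1 * q) ^+ n.
      by rewrite exprMn; ring.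
    rewrite TL mulVf ?gt_eqF// expr1n mulr1 /L.
    set D := K * a0 `^ eps * (1 - q).
    have D0 : D != 0 by rewrite /D !mulf_neq0 ?gt_eqF ?powR_gt0 ?subr_gt0.
    by rewrite (_ : _ * D * (2 / D) = 2 * a n); [rewrite /a exprS; ring|field].
  apply: ler_wpM2l; last by rewrite lerD2r ltW.
  apply: mulr_ge0; last exact: powR_ge0.
  apply: mulr_ge0; last by rewrite exprn_ge0// invr_ge0 ltW.
  apply: mulr_ge0; last exact: powR_ge0.
  by apply: mulr_ge0; exact: ltW.
pose x0 : Rd R d := [tuple (0 : measurableTypeR R) | i < d].
have [fin _] := moment_decomposition x0 T0.
have [m m0 mE] : exists2 m : R, 0 <= m & second_moment T x0 = m%:E.
  by apply: ge0_lty_EFin => //; apply: integral_ge0 => w _; rewrite lee_fin sqr_ge0.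
pose n := Num.bound (m / a0).
have := key n T x0; rewrite mE lee_fin lexx => H.
have sT : s n < T by rewrite gtr_pMr// gtrBl exprn_gt0.
have := H sT isT; rewrite leNgt => /negP; apply.
rewrite /a mulrC -ltr_pdivrMr//.
apply: lt_trans (archi_boundP _) _; first by rewrite divr_ge0// ltW.
by rewrite -natrX ltr_nat ltn_expl.
Qed.

End blow_up.

Theorem theorem3 (R : realType) (nu beta alpha : R) (d : nat)
    (p : R -> Rd R d -> R) (g : R -> R)
    (disp : measure_display) (Omega : measurableType disp)
    (P : probability Omega R) (F : R -> set (set Omega))
    (W : (measurableTypeR R * Rd R d -> R) -> Omega -> R)
    (u0 : Rd R d -> R) (sigma : R -> R) (eps : R) :
  0 < nu -> 0 < beta < 1 -> 0 < alpha <= 2 ->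
  (1 <= d)%N -> d%:R < Num.min 2 beta^-1 * alpha ->
  stable_density nu alpha p -> subordinator_density beta g ->
  filtration P F -> white_noise P F W ->
  measurable_fun setT u0 -> (exists M, forall x, `|u0 x| <= M) ->
  0 < inf (range u0) ->
  0 < eps ->
  0 < inf [set `|sigma y| / `|y| `^ (1 + eps) | y in [set y : R | y != 0]] ->
  ~ exists u : R -> Rd R d -> Omega -> R,
      finite_energy_solution P F W (heat_kernel beta p g) sigma u0 u.
Proof.
move=> nu0 /andP[beta0 _] /andP[alpha0 _] d0 dlt sp sg FF wn mu0 [M uM] k0 eps0 c0.
move=> [u [mild _ _]].
apply: (@no_mild_solution R nu beta alpha d p g disp Omega P F W u0 sigma eps
  nu0 beta0 alpha0 d0 _ sp sg FF wn mu0 _ (inf (range u0)) _ k0 c0 eps0 _ _ u mild).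
- have db : d%:R < beta^-1 * alpha.
    by apply: lt_le_trans dlt _; rewrite ler_pM2r// ge_min lexx orbT.
  rewrite ltr_pdivrMr// mul1r -(mulVKf (lt0r_neq0 beta0) alpha).
  by rewrite ltr_pM2l.
- by exists M.
- move=> x; apply: ge_inf; last by exists x.
  by exists (- M) => _ [y _ <-]; have := uM y; rewrite ler_norml => /andP[].
- move=> y y0; rewrite -ler_pdivlMr ?powR_gt0 ?normr_gt0//.
  apply: ge_inf; last by exists y.
  by exists 0 => _ [z _ <-]; rewrite divr_ge0 ?powR_ge0.
Qed.
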